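(* Let $f$ be analytic in $\mathbb{D}$ with $f(0)=1$. If there is a strictly increasing sequence $(n_{k})_{k}\subset\mathbb{N}$, and sequences $(\lambda_{k})_{k}$ and $(p_{k})_{k}$ with $\lambda_{k}\in(0,\frac{2\pi}{n_{k}})$, $p_{k}\in\mathcal{PD}_{n_{k}}(\lambda_{k})$, and $p_{k}^{*n_{k}}(0)=1$ for all $k\in\mathbb{N}$, such that $p_{k}^{*n_{k}}\to f$ uniformly on compact subsets of $\mathbb{D}$ as $k\to\infty$, then $f\in\mathcal{R}_{1}$.
   Context: All polynomials have complex coefficients. $\mathbb{D}$ is the open unit disk, $\mathbb{T}$ the unit circle. $\mathcal{R}_{1}$ is the set of functions $f$ analytic in $\mathbb{D}$ with $f(0)=1$ and $\operatorname{Re}f(z)>\frac12$ for all $z\in\mathbb{D}$. For a polynomial $p$ of degree $\le n$ its $n$-inverse is $p^{*n}(z)=z^{n}\overline{p(1/\overline{z})}$, i.e. $\bigl(\sum_{j=0}^n a_jz^j\bigr)^{*n}=\sum_{j=0}^n\overline{a_{n-j}}z^j$. For $n\in\mathbb{N}$ and $\lambda\in(0,\frac{2\pi}{n})$: the numbers $C_{j}^{(n)}(\lambda)$ are defined by $$\prod_{j=1}^{n}\bigl(1+e^{i(2j-n-1)\lambda/2}z\bigr)=\sum_{j=0}^{n}C_{j}^{(n)}(\lambda)z^{j}.$$ $\mathcal{T}_{n}(\lambda)$ is the set of polynomials of degree $n$ all of whose zeros lie on $\mathbb{T}$ and such that each pair of zeros (counted with multiplicity) is separated by an angle $>\lambda$.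 $\mathcal{D}_{n}(\lambda)$ is the union of $\mathcal{T}_{n}(\lambda)$ with the set of all polynomials $F$ of degree $n$ for which $$\operatorname{Im}\Bigl(e^{-in\lambda/2}\frac{F(e^{i\lambda/2}z)}{F(e^{-i\lambda/2}z)}\Bigr)>0\quad\text{for all } z\in\mathbb{C}\setminus\mathbb{D}.$$ $\mathcal{PD}_{n}(\lambda)$ is the set of all polynomials $p(z)=\sum_{j=0}^{n}a_{j}z^{j}$ with $\sum_{j=0}^{n}C_{j}^{(n)}(\lambda)a_{j}z^{j}\in\mathcal{D}_{n}(\lambda)$. *)

(* Defs.v *)
(* MathComp-Analysis: the complex numbers are R[i] over an arbitrary
   R : realType.  Polynomials live over the field R[i]; the topology, the
   norm and the (complex) derivative are those of the normed module R[i]^o. *)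
From HB Require Import structures.
From mathcomp Require Import all_boot all_order all_algebra.
From mathcomp Require Import complex.
From mathcomp Require Import all_classical all_reals all_analysis.

Set Implicit Arguments.
Unset Strict Implicit.
Unset Printing Implicit Defensive.

Import Order.TTheory GRing.Theory Num.Theory.
Import numFieldNormedType.Exports.
Local Open Scope classical_set_scope.
Local Open Scope ring_scope.

(* e^{it} *)
Definition expi (R : realType) (t : R) : R[i] := (cos t +i* sin t)%C.

Definition unit_disk (R : realType) : set R[i]^o := [set z | `|z| < 1].

(* Since the scalar field of R[i]^o is R[i], [derivable] is complex
   differentiability. *)
Definition analytic_on_disk (R : realType) (f : R[i]^o -> R[i]^o) : Prop :=
  forall z : R[i]^o, unit_disk z -> derivable f z 1.

Definition class_R1 (R : realType) : set (R[i]^o -> R[i]^o) :=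
  [set f | [/\ analytic_on_disk f, f 0 = 1 &
               forall z : R[i]^o, unit_disk z -> 2^-1 < complex.Re (f z)]].

(* For deg p <= n this is z ^ n * conj (p (1 / conj z)). *)
Definition ninverse (R : realType) (n : nat) (p : {poly R[i]}) : {poly R[i]} :=
  \poly_(j < n.+1) (p`_(n - j)%N)^*.

Definition suffridge_poly (R : realType) (n : nat) (lambda : R) : {poly R[i]} :=
  \prod_(1 <= j < n.+1)
    (1 + (expi (((2 * j)%N%:R - n%:R - 1) * lambda / 2)) *: 'X).

Definition Ccoef (R : realType) (n : nat) (lambda : R) (j : nat) : R[i] :=
  (suffridge_poly n lambda)`_j.

(* The angle in [0, pi] between two points of the unit circle, i.e. the
   length of the shorter arc joining them. *)
Definition angle (R : realType) (z w : R[i]) : R := acos (complex.Re (z * w^*)).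

(* s lists the zeros of F with multiplicity. *)
Definition class_T (R : realType) (n : nat) (lambda : R) : set {poly R[i]} :=
  [set F : {poly R[i]} | size F = n.+1 /\
     exists s : seq R[i],
       [/\ F = lead_coef F *: \prod_(z <- s) ('X - z%:P),
           forall z, z \in s -> `|z| = 1 &
           pairwise (fun z w => lambda < angle z w) s]].

(* Division by 0 yields 0 in R[i], so the strict inequality forces the
   denominator not to vanish for |z| >= 1. *)
Definition class_D (R : realType) (n : nat) (lambda : R) : set {poly R[i]} :=
  class_T n lambda `|`
  [set F : {poly R[i]} | size F = n.+1 /\
     forall z : R[i], 1 <= `|z| ->
       0 < complex.Im (expi (- (n%:R * lambda / 2)) *
                       (F.[expi (lambda / 2) * z] /
                        F.[expi (- (lambda / 2)) * z]))].

Definition class_PD (R : realType) (n : nat) (lambda : R) : set {poly R[i]} :=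
  [set p | (size p <= n.+1)%N /\
     class_D n lambda (\poly_(j < n.+1) (Ccoef n lambda j * p`_j))].

(* Main.v *)
Require Import Defs.
From HB Require Import structures.
From mathcomp Require Import all_boot all_order all_algebra.
From mathcomp Require Import complex polyrcf.
From mathcomp Require Import all_classical all_reals all_analysis.
From mathcomp Require Import ring lra zify.

Set Implicit Arguments.
Unset Strict Implicit.
Unset Printing Implicit Defensive.

Import Order.TTheory GRing.Theory Num.Theory.
Import numFieldNormedType.Exports.
Local Open Scope classical_set_scope.
Local Open Scope ring_scope.

(** Why the theorem is true.

    Write [b j] for the coefficients of [ninverse n p], so that [b 0 = 1], and
    let [Q] be the polynomial with coefficients [Ccoef n lam (n - j) * b j].
    Both ways of belonging to [class_D] say that, in the unit disk, the product
    of [expi (- (n lam / 2))] and [Q(expi (lam/2) z) / Q(expi (-lam/2) z)] has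
    negative imaginary part; for [class_T] this is a partial fraction expansion
    whose residues have the right sign because the zeros are separated
    ([class_T_Im]).  The numbers [Ccoef] satisfy a two-term recursion with sine
    coefficients ([Ccoef_rec]), and through it this sign condition becomes
    [|A| < |B|] in the disk for
      [B = \sum_j E j * b j * z ^ j],  [A = \sum_j E j * b j.+1 * z ^ j.+1].
    Hence [nu = B / (B - A)] has real part at least [1/2], so its coefficients
    are the moments of a probability measure on the circle.  Comparing
    coefficients in [(B - A) nu = B] gives [class_PD_blocks]:
      [b j = \sum_(m < j) (1 - r m) * r m.+1 * ... * r j.-1 * nu (j - m) * b m],
    with [r l = sin (l lam / 2) / sin ((n - l) lam / 2)].

    Let [delta = 2 pi / lam - n > 0].  If [2 l <= n], then [r l] differs from
    [l / (delta + l)] by at most [16 l / n] ([sine_ratio_urn]).  This bound is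
    uniform in [lam], so that all possible sizes of [n lam] are covered at
    once.  For the ratios [l / (delta + l)] the
    recursion is solved by the moments of the mean [X] of a Dirichlet process
    with parameter [delta] and base measure [nu]; the stick-breaking identity
    [X = (1 - T) x + T X'], with [T] beta distributed, [x] of law [nu] and [X']
    an independent copy of [X], characterises them
    ([block_solution_contractive]).

    So each fixed coefficient of [ninverse (n k) (p k)] is close to a moment of
    a probability on the closed disk, and [f z] is a limit of averages of
    [1 / (1 - x z)] with [|x| <= 1].  For [|z| = r < 1] all these values lie in
    the closed disk with centre [1 / (1 - r^2)] and radius [r / (1 - r^2)],
    hence [Re (f z) >= 1 / (1 + r) > 1/2].

    Probability measures are never constructed: a sequence [u] stands for the
    linear functional sending ['X^j] to [u j], and the only property used is
    that it is bounded by the supremum over the closed unit disk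
    ([contractive]).  *)

(** * The modulus and the unit circle *)

Section ComplexModulus.
Variable R : realType.
Implicit Types (z w : R[i]) (t : R).

Local Notation nc := (@Normc.normc R).

(** The norm of [R[i]] takes values in [R[i]], which is only partially
    ordered; estimates are made with its real-valued counterpart. *)
Lemma normE z : `|z| = (nc z)%:C%C.
Proof. by case: z. Qed.

Lemma ncD z w : nc (z + w) <= nc z + nc w.
Proof. exact: le_normcD. Qed.

Lemma ncN z : nc (- z) = nc z.
Proof. exact: normcN. Qed.

Lemma ncBC z w : nc (z - w) = nc (w - z).
Proof. by rewrite -ncN opprB. Qed.

Lemma nc_ge0 z : 0 <= nc z.
Proof. by case: z => a b; apply: sqrtr_ge0. Qed.

Lemma nc0 : nc 0 = 0. Proof. exact: Normc.normc0. Qed.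
Lemma nc1 : nc 1 = 1. Proof. exact: Normc.normc1. Qed.

Lemma ncM z w : nc (z * w) = nc z * nc w.
Proof. exact: Normc.normcM. Qed.

Lemma ncV z : nc z^-1 = (nc z)^-1.
Proof. exact: Normc.normcV. Qed.

Lemma nc_eq0 z : (nc z == 0) = (z == 0).
Proof.
by apply/eqP/eqP => [|->]; [exact: Normc.eq0_normc | exact: nc0].
Qed.

Lemma nc_gt0 z : (0 < nc z) = (z != 0).
Proof. by rewrite lt_def nc_ge0 andbT nc_eq0. Qed.

Lemma ncX z k : nc (z ^+ k) = nc z ^+ k.
Proof. by elim: k => [|k IH]; rewrite ?expr0 ?nc1 // !exprS ncM IH. Qed.

Lemma nc_sum (I : Type) (r : seq I) (P : pred I) (F : I -> R[i]) :
  nc (\sum_(i <- r | P i) F i) <= \sum_(i <- r | P i) nc (F i).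
Proof.
elim/big_rec2: _ => [|i x y _ le_yx]; first by rewrite nc0.
by rewrite (le_trans (ncD _ _)) // lerD2l.
Qed.

Lemma nc_real t : nc (t%:C%C) = `|t|.
Proof. by rewrite /= expr0n addr0 sqrtr_sqr. Qed.

Lemma nc_conj z : nc (z^*) = nc z.
Proof. by case: z => a b /=; rewrite sqrrN. Qed.

Lemma sqr_nc z : nc z ^+ 2 = complex.Re z ^+ 2 + complex.Im z ^+ 2.
Proof. by case: z => a b /=; rewrite sqr_sqrtr // addr_ge0 // sqr_ge0. Qed.

Lemma normRe_le z : `|complex.Re z| <= nc z.
Proof.
rewrite -(@ler_pXn2r _ 2) // ?nnegrE ?nc_ge0 // sqr_nc real_normK ?num_real //.
by rewrite lerDl sqr_ge0.
Qed.

Lemma Re_le z : complex.Re z <= nc z.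
Proof. exact: le_trans (ler_norm _) (normRe_le z). Qed.

Lemma nc_expi t : nc (expi t) = 1.
Proof. by rewrite /= cos2Dsin2 sqrtr1. Qed.

Lemma expi0 : expi 0 = 1 :> R[i].
Proof. by rewrite /expi cos0 sin0. Qed.

Lemma expiD t u : expi (t + u) = expi t * expi u.
Proof.
by apply/eqP; rewrite eq_complex /= sinD cosD eqxx addrC eqxx.
Qed.

Lemma expiN t : expi (- t) = (expi t)^*.
Proof. by rewrite /expi cosN sinN. Qed.

Lemma expi_neq0 t : expi t != 0.
Proof. by rewrite -nc_gt0 nc_expi. Qed.

Lemma expiX t k : expi t ^+ k = expi (k%:R * t).
Proof.
elim: k => [|k IH]; first by rewrite mul0r expi0.
by rewrite exprS IH -expiD -nat1r mulrDl mul1r.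
Qed.

Lemma Re_real z t : complex.Re (t%:C%C * z) = t * complex.Re z.
Proof. by case: z => a b /=; rewrite mul0r subr0. Qed.
Lemma Im_real z t : complex.Im (t%:C%C * z) = t * complex.Im z.
Proof. by case: z => a b /=; rewrite mul0r addr0. Qed.
Lemma ReD z w : complex.Re (z + w) = complex.Re z + complex.Re w.
Proof. by case: z; case: w. Qed.
Lemma ImD z w : complex.Im (z + w) = complex.Im z + complex.Im w.
Proof. by case: z; case: w. Qed.
Lemma ReN z : complex.Re (- z) = - complex.Re z.
Proof. by case: z. Qed.
Lemma ImN z : complex.Im (- z) = - complex.Im z.
Proof. by case: z. Qed.

End ComplexModulus.

(** * Moment functionals and averages over roots of unity *)

Section Mean.
Variable R : realType.
Local Notation nc := (@Normc.normc R).

(** For the moments [u] of a measure this is the integral of [P]. *)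
Definition mean (u : nat -> R[i]) (P : {poly R[i]}) : R[i] :=
  \sum_(j < size P) P`_j * u j.

Implicit Types (u : nat -> R[i]) (P : {poly R[i]}).

Lemma mean_widen u P N : (size P <= N)%N -> mean u P = \sum_(j < N) P`_j * u j.
Proof.
move=> leN; rewrite /mean (big_ord_widen N (fun j => P`_j * u j)) // big_mkcond.
apply: eq_bigr => j _; case: ltnP => // /leq_sizeP/(_ j (leqnn _)) ->.
by rewrite mul0r.
Qed.

Lemma mean_is_scalar u : scalar (mean u).
Proof.
move=> a P Q; set N := maxn (size (a *: P + Q)) (maxn (size P) (size Q)).
rewrite !(@mean_widen _ _ N) ?leq_max ?leqnn ?orbT // mulr_sumr -big_split /=.
by apply: eq_bigr => j _; rewrite coefD coefZ mulrDl mulrA.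
Qed.
HB.instance Definition _ u :=
  GRing.isLinear.Build R[i] {poly R[i]} R[i] *%R (mean u) (mean_is_scalar u).

Lemma meanXn u j : mean u 'X^j = u j.
Proof.
rewrite /mean size_polyXn big_ord_recr /= coefXn eqxx mul1r big1 ?add0r // => i _.
by rewrite coefXn ltn_eqF ?mul0r.
Qed.

Lemma meanC u a : u 0%N = 1 -> mean u a%:P = a.
Proof.
by move=> u0; rewrite -alg_polyC linearZ /= -(expr0 'X) meanXn u0 mulr1.
Qed.

(** Together with [u 0 = 1] this replaces the existence of a probability
    measure on the closed unit disk with moments [u]: a functional of norm one
    that fixes the constants is given by such an average. *)
Definition contractive u := forall P M,
  (forall y, nc y <= 1 -> nc P.[y] <= M) -> nc (mean u P) <= M.

Lemma contractive_le1 u j : contractive u -> nc (u j) <= 1.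
Proof.
move=> /(_ 'X^j 1); rewrite meanXn; apply=> y y1.
by rewrite hornerXn ncX exprn_ile1 ?nc_ge0.
Qed.

Lemma cos_lt1 (x : R) : 0 < `|x| < 2 * pi -> cos x < 1.
Proof.
move=> /andP[x0 x2]; rewrite -cos_norm.
have -> : `|x| = (`|x| / 2) *+ 2 by rewrite -mulr_natr divfK.
rewrite cos_mulr2n cos2sin2.
have : 0 < sin (`|x| / 2) by apply: sin_gt0_pi; lra.
by nra.
Qed.

Definition unity_pt M l : R[i] := expi (2 * pi * l%:R / M%:R).

Lemma nc_unity_pt M l : nc (unity_pt M l) = 1.
Proof. exact: nc_expi. Qed.

Lemma expi_2pin k : expi (k%:R * (2 * pi)) = 1 :> R[i].
Proof.
rewrite -expiX; have -> : expi (2 * pi : R) = 1 :> R[i].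
  by rewrite mulr_natl /expi cos2pi sin2pi.
by rewrite expr1n.
Qed.

(** The powers of a nontrivial [M]-th root of unity sum to zero. *)
Lemma sum_unity_pt M i j : (i < M)%N -> (j < M)%N ->
  \sum_(l < M) unity_pt M l ^+ i * (unity_pt M l ^+ j)^* = M%:R * (i == j)%:R.
Proof.
move=> iM jM; have M0 : M%:R != 0 :> R by rewrite pnatr_eq0; lia.
pose x : R := 2 * pi * (i%:R - j%:R) / M%:R.
have E l : unity_pt M l ^+ i * (unity_pt M l ^+ j)^* = expi x ^+ l.
  by rewrite !expiX -[(_)^*]expiN -expiD; congr expi; rewrite /x; field.
under eq_bigr do rewrite E.
have [eq_ij|neq_ij] := eqVneq i j.
  have -> : x = 0 by rewrite /x eq_ij subrr mulr0 mul0r.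
  under eq_bigr do rewrite expi0 expr1n.
  by rewrite sumr_const card_ord mulr1.
rewrite mulr0; apply/eqP.
have w1 : expi x != 1.
  apply/eqP => -[cx _]; suff : cos x < 1 by rewrite cx ltxx.
  apply: cos_lt1; rewrite /x -mulrA normrM ger0_norm ?mulr_ge0 ?pi_ge0 //.
  have pi0 := pi_gt0 R; have Mp : 0 < M%:R :> R by rewrite ltr0n; lia.
  have : 0 < `|(i%:R - j%:R) / M%:R : R| < 1.
    rewrite normr_gt0 mulf_neq0 ?invr_eq0 ?subr_eq0 ?eqr_nat //=.
    rewrite normrM normfV [`|M%:R|]ger0_norm ?ltr_pdivrMr ?mul1r ?ler0n //.
    have : (i%:R : R) < M%:R by rewrite ltr_nat.
    have : (j%:R : R) < M%:R by rewrite ltr_nat.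
    have : (0 : R) <= i%:R by []. have : (0 : R) <= j%:R by [].
    by move=> *; rewrite ltr_norml; lra.
  by move=> /andP[h1 h2]; nra.
have /eqP := subrX1 (expi x) M.
have -> : expi x ^+ M = 1.
  rewrite expiX; have -> : M%:R * x = i%:R * (2 * pi) - j%:R * (2 * pi).
    by rewrite /x; field.
  by rewrite expiD expiN !expi_2pin rmorph1 mulr1.
by rewrite subrr eq_sym mulf_eq0 subr_eq0 (negPf w1).
Qed.

Lemma coef_sum_unity_pt (P : {poly R[i]}) rho M j : (size P <= M)%N -> (j < M)%N ->
  \sum_(l < M) P.[rho * unity_pt M l] * (unity_pt M l ^+ j)^* =
  M%:R * (P`_j * rho ^+ j).
Proof.
move=> PM jM; under eq_bigr do rewrite (horner_coef_wide _ PM) mulr_suml.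
rewrite exchange_big /= (bigD1 (Ordinal jM)) //= [X in _ + X]big1 ?addr0.
  under eq_bigr do rewrite exprMn -!mulrA.
  by rewrite -!mulr_sumr sum_unity_pt // eqxx mulr1; ring.
move=> i /negPf; rewrite -val_eqE /= => ij.
under eq_bigr do rewrite exprMn -!mulrA.
by rewrite -!mulr_sumr sum_unity_pt // ij !mulr0.
Qed.

(** Cauchy's estimate; for a polynomial the contour integral is an average
    over sufficiently many roots of unity. *)
Lemma coef_bound (P : {poly R[i]}) (rho B : R) j : 0 <= rho ->
  (forall t, 0 <= t <= 2 * pi -> nc P.[rho%:C%C * expi t] <= B) ->
  nc P`_j * rho ^+ j <= B.
Proof.
move=> rho0 PB; pose M := maxn (size P) j.+1.
have M0 : 0 < M%:R :> R by rewrite ltr0n leq_max orbT.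
rewrite -(ler_pM2l M0).
have ncM_nat : nc M%:R = M%:R by rewrite -(rmorph_nat (real_complex R)) nc_real ger0_norm.
have <- : nc (M%:R * (P`_j * rho%:C%C ^+ j)) = M%:R * (nc P`_j * rho ^+ j).
  by rewrite !ncM ncM_nat ncX nc_real ger0_norm.
rewrite -coef_sum_unity_pt ?leq_max ?leqnn ?orbT //.
apply: le_trans (nc_sum _ _ _) _.
rewrite mulr_natl -[X in _ <= _ *+ X]card_ord -sumr_const ler_sum // => l _.
rewrite ncM nc_conj ncX nc_unity_pt expr1n mulr1 PB //.
have pi0 := pi_ge0 R; rewrite divr_ge0 ?mulr_ge0 //= ler_pdivrMr //.
by rewrite ler_wpM2l ?mulr_ge0 // ler_nat ltnW.
Qed.

End Mean.

(** * Coefficients of a function with real part at least one half *)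

Section PolyApproximation.
Variable R : realType.
Local Notation nc := (@Normc.normc R).
Implicit Types (u : nat -> R[i]) (P V B D : {poly R[i]}).

Lemma le_of_eps (x M C : R) : 0 <= C ->
  (forall e, 0 < e < 1 -> x <= M + e * C) -> x <= M.
Proof.
move=> C0 H; rewrite leNgt; apply/negP => Mx.
(* Small enough that [e * C] does not exceed half of the gap [x - M]. *)
pose e := Num.min (1 / 2) ((x - M) / (2 * (C + 1))).
have eP : 0 < e by rewrite lt_min !divr_gt0 ?subr_gt0 ?mulr_gt0 ?ltr_wpDl.
have e1 : e <= 1 / 2 by rewrite ge_min lexx.
have e2 : e * (C + 1) <= (x - M) / 2.
  have : e <= (x - M) / (2 * (C + 1)) by rewrite ge_min lexx orbT.
  rewrite -(@ler_pM2r _ (C + 1)) ?ltr_wpDl // => /le_trans -> //.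
  by rewrite le_eqVlt; apply/orP; left; apply/eqP; field; lra.
have := H e; have : 0 < e < 1 by lra.
move=> -> /(_ isT); nra.
Qed.

(** The functional is the average of [P] over roots of unity against the
    weights [2 Re V - 1], up to an error supported by the constant coefficient.
    These weights are nearly nonnegative and have total mass close to one. *)
Lemma mean_Herglotz_poly V P (eps M : R) : 0 <= eps ->
  (forall w, nc w = 1 -> 2^-1 - eps <= complex.Re V.[w]) ->
  (forall y, nc y <= 1 -> nc P.[y] <= M) ->
  nc (mean (fun j => V`_j) P) <= M * (1 + 4 * eps + 3 * nc (V`_0 - 1)).
Proof.
move=> eps0 Vge PM; pose Vc := map_poly Num.conj V.
(* More points than the degrees involved, so that no coefficients are aliased. *)
pose K := maxn (maxn (size P) (size V)) (size (P * Vc)%R).+1.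
have PK : (size P <= K)%N by rewrite /K !leq_max leqnn.
have VK : (size V <= K)%N by rewrite /K !leq_max leqnn orbT.
have PVK : (size (P * Vc)%R <= K)%N by rewrite /K !leq_max leqnSn orbT.
have K0 : (0 < K)%N by rewrite /K !leq_max ltn0Sn orbT.
pose w l := unity_pt R K l.
have nw l : nc (w l) = 1 by exact: nc_unity_pt.
have nwc l : nc (w l)^* = 1 by rewrite nc_conj.
have E1 : \sum_(l < K) P.[w l] * V.[(w l)^*] = K%:R * mean (fun j => V`_j) P.
  rewrite (mean_widen _ PK) mulr_sumr.
  under eq_bigr do rewrite (horner_coef_wide _ VK) mulr_sumr.
  rewrite exchange_big /=; apply: eq_bigr => j _.
  have := coef_sum_unity_pt 1 PK (ltn_ord j); rewrite expr1n mulr1 mulrA => <-.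
  rewrite mulr_suml; apply: eq_bigr => l _; rewrite mul1r rmorphXn /=; ring.
have E2 : \sum_(l < K) P.[w l] * (V.[(w l)^*])^* = K%:R * (P`_0 * (V`_0)^*).
  have := coef_sum_unity_pt 1 PVK K0; rewrite expr0 mulr1 coef0M coef_map /= => <-.
  apply: eq_bigr => l _; rewrite expr0 rmorph1 mulr1 mul1r hornerM; congr (_ * _).
  by rewrite -horner_map /= conjCK.
have E3 : \sum_(l < K) V.[(w l)^*] = K%:R * V`_0.
  have := coef_sum_unity_pt 1 (P := Vc) (M := K) (j := 0).
  rewrite size_map_poly => /(_ VK K0); rewrite expr0 mulr1 coef_map /=.
  move=> /(congr1 Num.conj); rewrite rmorphM /= conjCK rmorph_nat => <-.
  rewrite rmorph_sum /=; apply: eq_bigr => l _.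
  rewrite expr0 rmorph1 mulr1 mul1r.
  transitivity ((Vc.[((w l)^*)^*])^*); last by rewrite conjCK.
  by rewrite horner_map /= conjCK.
have M0 : 0 <= M by apply: le_trans (nc_ge0 _) (PM 0 _); rewrite nc0.
have P0M : nc P`_0 <= M by rewrite -horner_coef0 PM // nc0.
have Kp : 0 < K%:R :> R by rewrite ltr0n.
(* The weights; the conjugate point makes the average of [P * V] pair equal indices. *)
pose t l : R := 2 * complex.Re V.[(w l)^*] - 1.
have E4 : \sum_(l < K) P.[w l] * (t l)%:C%C =
    K%:R * (mean (fun j => V`_j) P + P`_0 * ((V`_0)^* - 1)).
  transitivity (\sum_(l < K) (P.[w l] * V.[(w l)^*] +
     P.[w l] * (V.[(w l)^*])^* - P.[w l])).
    apply: eq_bigr => l _.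
    have -> : (t l)%:C%C = V.[(w l)^*] + (V.[(w l)^*])^* - 1.
      rewrite /t; case: V.[_] => a b; apply/eqP; rewrite eq_complex /=.
      by apply/andP; split; apply/eqP; ring.
    by ring.
  rewrite big_split big_split sumrN /= E1 E2.
  have := coef_sum_unity_pt 1 PK K0; rewrite expr0 mulr1 => E.
  have -> : \sum_(l < K) P.[w l] = K%:R * P`_0.
    by rewrite -E; apply: eq_bigr => l _; rewrite expr0 rmorph1 mulr1 mul1r.
  by ring.
have ncK : nc K%:R = K%:R by rewrite -(rmorph_nat (real_complex R)) nc_real ger0_norm.
have sumt : \sum_(l < K) t l = K%:R * (2 * complex.Re V`_0 - 1).
  rewrite sumrB -mulr_sumr sumr_const card_ord.
  have -> : \sum_(l < K) complex.Re V.[(w l)^*] = complex.Re (K%:R * V`_0).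
    rewrite -E3; elim/big_ind2: _ => // x1 x2 y1 y2.
    by move=> -> ->; rewrite ReD.
  by rewrite -(rmorph_nat (real_complex R)) Re_real; ring.
have B1 : nc (mean (fun j => V`_j) P + P`_0 * ((V`_0)^* - 1)) <=
    M * (2 * complex.Re V`_0 - 1 + 4 * eps).
  rewrite -(ler_pM2l Kp) -[X in X * nc _]ncK -ncM -E4.
  apply: le_trans (nc_sum _ _ _) _.
  have -> : K%:R * (M * (2 * complex.Re V`_0 - 1 + 4 * eps)) =
     \sum_(l < K) (M * (t l + 4 * eps)).
    rewrite -mulr_sumr big_split /= sumt sumr_const card_ord; ring.
  apply: ler_sum => l _; rewrite ncM nc_real.
  apply: ler_pM; rewrite ?nc_ge0 ?normr_ge0 // ?PM ?nw //.
  have := Vge _ (nwc l); rewrite /t => h.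
  by rewrite ler_norml; lra.
have -> : mean (fun j => V`_j) P = (mean (fun j => V`_j) P +
    P`_0 * ((V`_0)^* - 1)) - P`_0 * ((V`_0)^* - 1) by ring.
apply: le_trans (ncD _ _) _; rewrite ncN ncM.
have -> : nc ((V`_0)^* - 1) = nc (V`_0 - 1) by rewrite -nc_conj rmorphB /= conjCK rmorph1.
have : complex.Re V`_0 <= 1 + nc (V`_0 - 1).
  by have := Re_le (V`_0 - 1); rewrite ReD ReN /=; lra.
have := nc_ge0 (V`_0 - 1); have := nc_ge0 P`_0.
nra.
Qed.

(** Uniform approximability by polynomials on the closed disk replaces
    analyticity in a neighbourhood of it. *)
Definition poly_approx (g : R[i] -> R[i]) := forall e, 0 < e ->
  exists X : {poly R[i]}, forall z, nc z <= 1 -> nc (X.[z] - g z) <= e.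

Lemma poly_disk_bounded P : exists2 C, 0 <= C & forall z, nc z <= 1 -> nc P.[z] <= C.
Proof.
exists (\sum_(j < size P) nc P`_j); first by apply: sumr_ge0 => *; apply: nc_ge0.
move=> z z1; rewrite horner_coef; apply: le_trans (nc_sum _ _ _) _.
by apply: ler_sum => j _; rewrite ncM ncX ler_piMr ?nc_ge0 ?exprn_ile1 ?nc_ge0.
Qed.

Lemma poly_approx_bounded g : poly_approx g ->
  exists2 C, 0 <= C & forall z, nc z <= 1 -> nc (g z) <= C.
Proof.
move=> /(_ 1 ltr01)[X gX]; have [C C0 XC] := poly_disk_bounded X.
exists (C + 1); first exact: addr_ge0.
move=> z z1; rewrite -[g z](subKr X.[z]); apply: le_trans (ncD _ _) _.
by rewrite ncN lerD ?XC ?gX.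
Qed.

Lemma poly_approxM g h :
  poly_approx g -> poly_approx h -> poly_approx (fun z => g z * h z).
Proof.
move=> ag ah e e0; have [Cg Cg0 gC] := poly_approx_bounded ag.
have [Ch Ch0 hC] := poly_approx_bounded ah.
have e1 : 0 < Num.min 1 (e / 2 / (Cg + 1)).
  by rewrite lt_min ltr01 !divr_gt0 // ltr_wpDl.
have e2 : 0 < e / 2 / (Ch + 1) by rewrite !divr_gt0 // ltr_wpDl.
have [Y hY] := ah _ e1; have [X gX] := ag _ e2.
exists (X * Y) => z z1; rewrite hornerM.
have -> : X.[z] * Y.[z] - g z * h z =
  (X.[z] - g z) * Y.[z] + g z * (Y.[z] - h z) by ring.
apply: le_trans (ncD _ _) _; rewrite !ncM.
have Y1 : nc Y.[z] <= Ch + 1.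
  rewrite -[Y.[z]](subrK (h z)) addrC; apply: le_trans (ncD _ _) _.
  by rewrite lerD ?hC // (le_trans (hY z z1)) // ge_min lexx.
have -> : e = e / 2 / (Ch + 1) * (Ch + 1) + (Cg + 1) * (e / 2 / (Cg + 1)).
  by field; lra.
apply: lerD; apply: ler_pM; rewrite ?nc_ge0 ?gX //.
  by rewrite (le_trans (gC _ z1)) // lerDl.
by rewrite (le_trans (hY z z1)) // ge_min lexx orbT.
Qed.

Lemma poly_approx_cst c : poly_approx (fun=> c).
Proof. by move=> e e0; exists c%:P => z _; rewrite hornerC subrr nc0 ltW. Qed.

Lemma exists_expr_lt (q e : R) : 0 <= q < 1 -> 0 < e -> exists L, q ^+ L < e.
Proof.
move=> /andP[q0 q1] e0; have /cvgrPdist_lt/(_ e e0) : q ^+ n @[n --> \oo] --> (0 : R).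
  by apply: cvg_expr; rewrite ger0_norm.
move=> [N _ /(_ N (leqnn N))] /=; rewrite sub0r normrN ger0_norm ?exprn_ge0 //.
by exists N.
Qed.

(** Truncate the geometric series of [1 / (z - d)]. *)
Lemma poly_approx_inv_linear d : 1 < nc d -> poly_approx (fun z => (z - d)^-1).
Proof.
move=> d1 e e0; have d0 : d != 0 by rewrite -nc_gt0; lra.
have [||L Le] := @exists_expr_lt (nc d)^-1 (e * (nc d - 1)).
- by rewrite invr_ge0 nc_ge0 invf_lt1 // (lt_trans ltr01).
- by rewrite mulr_gt0 // subr_gt0.
exists (\sum_(l < L) (- d^-1 ^+ l.+1) *: 'X^l) => z z1.
have zd : z - d != 0.
  by apply/negP; rewrite subr_eq0 => /eqP zd; move: z1; rewrite zd; lra.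
have -> : (\sum_(l < L) (- d^-1 ^+ l.+1) *: 'X^l).[z] =
    (1 - (d^-1 * z) ^+ L) / (z - d).
  apply: (mulIf zd); rewrite divfK // -[1 - _]opprB subrX1 horner_sum -mulNr.
  have -> : - (d^-1 * z - 1) = - d^-1 * (z - d) by field.
  rewrite mulr_sumr mulr_suml; apply: eq_bigr => l _.
  by rewrite hornerZ hornerXn exprS exprMn; ring.
have -> : (1 - (d^-1 * z) ^+ L) / (z - d) - (z - d)^-1 =
  - (d^-1 * z) ^+ L / (z - d) by field.
rewrite ncM ncN ncX ncM !ncV.
have zd1 : nc d - 1 <= nc (z - d).
  have := ncD (d - z) z; rewrite subrK ncBC; lra.
rewrite ler_pdivrMr ?nc_gt0 //.
have : ((nc d)^-1 * nc z) ^+ L <= (nc d)^-1 ^+ L.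
  rewrite lerXn2r ?nnegrE ?mulr_ge0 ?invr_ge0 ?nc_ge0 //.
  by rewrite ler_piMr ?invr_ge0 ?nc_ge0.
nra.
Qed.

(** Factor [D] over its zeros, all outside the closed disk, and multiply the
    approximations of the inverse linear factors. *)
Lemma poly_approx_inv D : (forall z, nc z <= 1 -> D.[z] != 0) ->
  poly_approx (fun z => D.[z]^-1).
Proof.
have [rs ->] := closed_field_poly_normal D; move: (lead_coef D) => c D0.
have c0 : c != 0.
  by have := D0 0; rewrite nc0 hornerZ mulf_eq0 => /(_ ler01); case: eqP.
have : forall r, r \in rs -> 1 < nc r.
  move=> r rrs; rewrite ltNge; apply/negP => /D0; rewrite hornerZ mulf_eq0 negb_or.
  by rewrite -rootE root_prod_XsubC rrs andbF.
move=> {D0} rs1.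
suff : poly_approx (fun z => c^-1 * (\prod_(r <- rs) ('X - r%:P)).[z]^-1).
  by move=> H e e0; have [X HX] := H e e0; exists X => z /HX; rewrite hornerZ invfM.
apply: poly_approxM; first exact: poly_approx_cst.
elim: rs rs1 => [|r rs IH] rs1.
  move=> e e0; have [X HX] := @poly_approx_cst 1 e e0; exists X => z /HX.
  by rewrite big_nil hornerC invr1.
have ar : poly_approx (fun z => (z - r)^-1).
  by apply: poly_approx_inv_linear; rewrite rs1 ?mem_head.
have ars := IH (fun x xrs => rs1 x (mem_behead (s := r :: rs) xrs)).
move=> e e0; have [X HX] := poly_approxM ar ars e0; exists X => z /HX.
by rewrite big_cons hornerM hornerXsubC invfM.
Qed.

End PolyApproximation.

Section Caratheodory.
Variable R : realType.
Local Notation nc := (@Normc.normc R).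
Implicit Types (u nu : nat -> R[i]) (P V B D : {poly R[i]}).

(** [nu] is the power series of [B / D]. *)
Definition is_quotient nu B D :=
  forall j, \sum_(i < j.+1) nu i * D`_(j - i) = B`_j.

(** The first coefficients of a quotient are computed by a triangular system,
    so they depend continuously on the right-hand side. *)
Lemma quotient_stable nu B D J : D`_0 != 0 -> is_quotient nu B D ->
  exists2 K, 0 <= K & forall V e, (forall j, nc ((V * D)`_j - B`_j) <= e) ->
    forall j, (j <= J)%N -> nc (V`_j - nu j) <= K * e.
Proof.
move=> D0 DB; have D0p : 0 < nc D`_0 by rewrite nc_gt0.
have E V j : (V * D)`_j - B`_j =
    (V`_j - nu j) * D`_0 + \sum_(i < j) (V`_i - nu i) * D`_(j - i).
  rewrite -DB coefM !big_ord_recr /= subnn.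
  under [X in _ = _ + X]eq_bigr do rewrite mulrBl.
  rewrite sumrB; ring.
elim: J => [|J [K K0 IH]].
  exists (nc D`_0)^-1 => [|V e He j]; first by rewrite invr_ge0 nc_ge0.
  rewrite leqn0 => /eqP ->; rewrite mulrC ler_pdivlMr // -ncM.
  by have := He 0%N; rewrite E big_ord0 addr0.
pose S := \sum_(i < J.+1) nc D`_(J.+1 - i).
have S0 : 0 <= S by apply: sumr_ge0 => *; apply: nc_ge0.
exists (K + (1 + K * S) / nc D`_0) => [|V e He j].
  by rewrite addr_ge0 ?divr_ge0 ?addr_ge0 ?mulr_ge0 ?nc_ge0.
have e0 : 0 <= e by apply: le_trans (nc_ge0 _) (He 0%N).
rewrite leq_eqVlt => /orP[/eqP -> | jJ]; last first.
  apply: le_trans (IH _ _ He _ jJ) _.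
  by rewrite ler_wpM2r // lerDl divr_ge0 ?addr_ge0 ?mulr_ge0 ?nc_ge0.
suff : nc (V`_J.+1 - nu J.+1) <= (1 + K * S) / nc D`_0 * e.
  by move=> /le_trans; apply; rewrite ler_wpM2r // lerDr.
rewrite mulrAC ler_pdivlMr // -ncM.
have := E V J.+1 => /esym/eqP; rewrite eq_sym -subr_eq => /eqP <-.
apply: le_trans (ncD _ _) _; rewrite ncN mulrDl mul1r lerD ?He //.
apply: le_trans (nc_sum _ _ _) _; rewrite mulrAC /S mulr_sumr ler_sum // => i _.
by rewrite ncM ler_wpM2r ?nc_ge0 // IH // -ltnS.
Qed.

Lemma mean_lipschitz P J e u v : (size P <= J)%N ->
  (forall j, (j < J)%N -> nc (u j - v j) <= e) ->
  nc (mean u P - mean v P) <= (\sum_(j < J) nc P`_j) * e.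
Proof.
move=> PJ uv; rewrite !(mean_widen _ PJ) -sumrB.
apply: le_trans (nc_sum _ _ _) _; rewrite mulr_suml ler_sum // => j _.
by rewrite -mulrBr ncM ler_wpM2l ?nc_ge0 ?uv.
Qed.

(** With [q = b / d], the inequality [|q - 1| <= |q|] says that [q] is closer
    to [1] than to [0]. *)
Lemma Re_quot_ge (b d : R[i]) : d != 0 -> nc (b - d) <= nc b ->
  2^-1 <= complex.Re (b / d).
Proof.
move=> d0 le_bd; have : nc (b / d - 1) <= nc (b / d).
  have -> : b / d - 1 = (b - d) / d by field.
  by rewrite !ncM ler_wpM2r ?nc_ge0.
move=> le1; have : nc (b / d - 1) ^+ 2 <= nc (b / d) ^+ 2.
  by rewrite lerXn2r ?nnegrE ?nc_ge0.
rewrite !sqr_nc ReD ImD ReN ImN /=.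
by rewrite expr2; nra.
Qed.

(** On the closed disk [B / D] has real part at least [1/2]; it is a uniform
    limit of polynomials to which [mean_Herglotz_poly] applies. *)
Lemma Caratheodory_closed nu B D : nu 0%N = 1 -> is_quotient nu B D ->
  (forall z, nc z <= 1 -> D.[z] != 0 /\ nc (B.[z] - D.[z]) <= nc B.[z]) ->
  contractive nu.
Proof.
move=> nu0 DB HD P M PM.
have D0 : D`_0 != 0 by rewrite -horner_coef0; case: (HD 0); rewrite ?nc0.
have [Cb Cb0 bC] := poly_disk_bounded B.
have [Cd Cd0 dC] := poly_disk_bounded D.
have [K K0 HK] := quotient_stable (size P) D0 DB.
pose S := \sum_(j < size P) nc P`_j.
have S0 : 0 <= S by apply: sumr_ge0 => *; apply: nc_ge0.
have M0 : 0 <= M by apply: le_trans (nc_ge0 _) (PM 0 _); rewrite nc0.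
pose e1 := Cb * Cd.
have e10 : 0 <= e1 by exact: mulr_ge0.
apply: (@le_of_eps _ _ _ (M * (4 * Cb + 3 * (K * e1)) + S * (K * e1))).
  by rewrite !(addr_ge0, mulr_ge0).
move=> e /andP[e0 _].
have [z|X HX] := @poly_approx_inv _ D _ e e0; first by case/HD.
pose V := B * X.
have Vq : forall j, nc ((V * D)`_j - B`_j) <= e1 * e.
  move=> j; rewrite -coefB; have := @coef_bound _ (V * D - B) 1 (e1 * e) j ler01.
  rewrite expr1n mulr1; apply => t _; rewrite mul1r; have w1 := nc_expi t; move: (expi t) w1 => w w1.
  have [|Dw _] := HD w; first by rewrite w1.
  rewrite hornerD hornerN !hornerM.
  have -> : B.[w] * X.[w] * D.[w] - B.[w] = B.[w] * D.[w] * (X.[w] - D.[w]^-1).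
    by field.
  by rewrite !ncM !ler_pM ?mulr_ge0 ?nc_ge0 ?bC ?dC ?HX ?w1.
have VnuJ := HK _ _ Vq.
have V0 : nc (V`_0 - 1) <= K * (e1 * e) by rewrite -nu0 VnuJ.
have Vre w : nc w = 1 -> 2^-1 - Cb * e <= complex.Re V.[w].
  move=> w1; have [|Dw BDw] := HD w; first by rewrite w1.
  have := Re_quot_ge Dw BDw.
  have -> : V.[w] = B.[w] / D.[w] + B.[w] * (X.[w] - D.[w]^-1).
    by rewrite hornerM; ring.
  rewrite ReD; have := normRe_le (B.[w] * (X.[w] - D.[w]^-1)).
  rewrite ler_norml => /andP[+ _].
  have : nc (B.[w] * (X.[w] - D.[w]^-1)) <= Cb * e.
    by rewrite ncM ler_pM ?nc_ge0 ?bC ?HX ?w1.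
  lra.
have Cbe : 0 <= Cb * e by rewrite mulr_ge0 // ltW.
have := mean_Herglotz_poly Cbe Vre PM.
have : nc (mean nu P - mean (fun j => V`_j) P) <= S * (K * (e1 * e)).
  by apply: mean_lipschitz => // j jP; rewrite ncBC VnuJ // ltnW.
have := ncD (mean nu P - mean (fun j => V`_j) P) (mean (fun j => V`_j) P).
rewrite subrK.
have : M * nc (V`_0 - 1) <= M * (K * (e1 * e)) by rewrite ler_wpM2l.
move: (nc _) (nc _) (nc _) (nc _) => x1 x2 x3 x4.
move=> h1 h2 h3 h4; nra.
Qed.

Definition dilate s P : {poly R[i]} := \poly_(j < size P) (P`_j * s ^+ j).

Lemma coef_dilate s P j : (dilate s P)`_j = P`_j * s ^+ j.
Proof.
rewrite coef_poly; case: ltnP => // /leq_sizeP/(_ j (leqnn _)) ->.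
by rewrite mul0r.
Qed.

Lemma horner_dilate s P z : (dilate s P).[z] = P.[s * z].
Proof.
rewrite horner_poly [RHS]horner_coef; apply: eq_bigr => j _.
by rewrite exprMn mulrA.
Qed.

Lemma exprn_defect (e : R) j : 0 <= e <= 1 -> 1 - (1 - e) ^+ j <= j%:R * e.
Proof.
move=> e01; elim: j => [|j IH]; first by rewrite expr0 subrr mul0r.
rewrite exprS -nat1r mulrDl mul1r.
have : (1 - e) ^+ j <= 1 by apply: exprn_ile1; lra.
nra.
Qed.

(** Apply the closed case to [B (s z)] and [D (s z)] and let the real number
    [s < 1] tend to [1]. *)
Theorem Caratheodory nu B D : nu 0%N = 1 -> is_quotient nu B D ->
  (forall z, nc z < 1 -> D.[z] != 0 /\ nc (B.[z] - D.[z]) <= nc B.[z]) ->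
  contractive nu.
Proof.
move=> nu0 DB HD P M PM.
pose S := \sum_(j < size P) nc P`_j.
have S0 : 0 <= S by apply: sumr_ge0 => *; apply: nc_ge0.
pose T := \sum_(j < size P) nc (nu j).
have T0 : 0 <= T by apply: sumr_ge0 => *; apply: nc_ge0.
apply: (@le_of_eps _ _ _ (S * (T * (size P)%:R))); first by rewrite !mulr_ge0.
move=> e /andP[e0 e1]; pose s := (1 - e)%:C%C : R[i].
have ncs : nc s = 1 - e by rewrite nc_real ger0_norm //; lra.
pose nus j := nu j * s ^+ j.
have cs : contractive nus.
  apply: (@Caratheodory_closed _ (dilate s B) (dilate s D)).
  - by rewrite /nus nu0 mulr1.
  - move=> j; rewrite coef_dilate -DB mulr_suml; apply: eq_bigr => i _.
    rewrite coef_dilate /nus.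
    have -> : s ^+ j = s ^+ i * s ^+ (j - i) by rewrite -exprD subnKC // -ltnS.
    by ring.
  - move=> z z1; rewrite !horner_dilate; apply: HD; rewrite ncM ncs.
    by have := nc_ge0 z; nra.
have := cs _ _ PM.
have : nc (mean nu P - mean nus P) <= S * (T * (size P)%:R * e).
  apply: mean_lipschitz => // j jP.
  have -> : nu j - nus j = nu j * (1 - s ^+ j) by rewrite /nus; ring.
  rewrite ncM -mulrA ler_pM ?nc_ge0 //.
    by rewrite /T (bigD1 (Ordinal jP)) //= lerDl sumr_ge0 // => *; apply: nc_ge0.
  have -> : 1 - s ^+ j = (1 - (1 - e) ^+ j)%:C%C by rewrite rmorphB rmorphXn rmorph1.
  have defect0 : 0 <= 1 - (1 - e) ^+ j by rewrite subr_ge0; apply: exprn_ile1; lra.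
  rewrite nc_real (ger0_norm defect0).
  apply: le_trans (@exprn_defect e j _) _; first by rewrite !ltW.
  by rewrite ler_wpM2r ?ler_nat ?(ltW e0) // ltnW.
have := ncD (mean nu P - mean nus P) (mean nus P); rewrite subrK.
lra.
Qed.
End Caratheodory.

(** * The beta distribution as a moment functional *)

Section Beta.
Variable R : realType.
Local Notation nc := (@Normc.normc R).

Lemma horner_continuous (p : {poly R}) : continuous (horner p : R -> R).
Proof.
move=> x; apply/cvgrPdist_lt => e e0; have [d d0 Hd] := poly_cont x p e0.
near=> y; rewrite distrC; apply: Hd; rewrite distrC.
by near: y; apply: (@cvgr_dist_lt _ R R (nbhs x) _ id).
Unshelve. all: by end_near.
Qed.

(** The sum is [delta] times the integral of [t ^ (delta - 1) * h t] over
    [0, 1].  The real power is avoided by noting that the polynomial [Y] with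
    the averaged coefficients solves [Y + t Y' / delta = h], which forbids a
    negative minimum of [Y] on [0, 1]: at a positive minimum point the
    derivative would have to be both positive and nonpositive. *)
Lemma beta_ge0 (delta : R) (h : {poly R}) : 0 < delta ->
  (forall t, 0 <= t <= 1 -> 0 <= h.[t]) ->
  0 <= \sum_(j < size h) h`_j * (delta / (delta + j%:R)).
Proof.
move=> d0 h_ge0; have dj j : 0 < delta + j%:R by rewrite ltr_wpDr.
pose Y := \poly_(j < size h) (h`_j * (delta / (delta + j%:R))).
have Yj j : Y`_j = h`_j * (delta / (delta + j%:R)).
  by rewrite coef_poly; case: ltnP => // /leq_sizeP/(_ j (leqnn _)) ->; rewrite mul0r.
have -> : \sum_(j < size h) h`_j * (delta / (delta + j%:R)) = Y.[1].
  by rewrite horner_poly; apply: eq_bigr => j _; rewrite expr1n mulr1.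
have ode t : h.[t] = Y.[t] + delta^-1 * (t * Y^`().[t]).
  have -> : h = Y + delta^-1 *: ('X * Y^`()).
    apply/polyP => j; rewrite coefD coefZ coefXM coef_deriv.
    case: j => [|j] /=; rewrite Yj ?mulr0.
      by rewrite addr0 mulr0n addr0 divff ?mulr1 // gt_eqF.
    by rewrite -mulr_natr; field; rewrite nat1r !gt_eqF.
  by rewrite hornerD hornerZ hornerM hornerX.
have [t0 t01 Ymin] := @EVT_min R (horner Y) 0 1 ler01
  (continuous_subspaceT (@horner_continuous Y)).
move: t01; rewrite in_itv /= => t01; have /andP[t00 t0_le1] := t01.
apply: le_trans (Ymin 1 _); last by rewrite in_itv /= lexx ler01.
rewrite leNgt; apply/negP => Y0.
have : 0 < t0 * Y^`().[t0].
  have := h_ge0 _ t01; rewrite ode => h1.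
  have : 0 < delta^-1 * (t0 * Y^`().[t0]) by lra.
  by rewrite pmulr_rgt0 ?invr_gt0.
rewrite lt_def => /andP[]; rewrite mulf_eq0 negb_or => /andP[t0N0 _].
have t0p : 0 < t0 by rewrite lt_def t0N0.
rewrite pmulr_rge0 // => dY_ge0.
have dY0 : 0 < Y^`().[t0].
  rewrite lt_def dY_ge0 andbT; apply/eqP => dY0.
  by have := h_ge0 _ t01; rewrite ode dY0; lra.
have /factor_theorem[Q YQ] : root (Y - Y.[t0]%:P) t0.
  by rewrite rootE hornerD hornerN hornerC subrr.
have dYQ : Y^`().[t0] = Q.[t0].
  have := congr1 (fun p => p^`().[t0]) YQ.
  rewrite /= derivB derivC subr0 => ->.
  by rewrite derivM derivXsubC !hornerE subrr mulr0 add0r.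
rewrite dYQ in dY0; have [d dp Qd] := poly_cont t0 Q dY0.
(* A point of [0, 1] slightly to the left of [t0], where [Y] would be smaller than at [t0]. *)
pose t := t0 - Num.min (d / 2) t0.
have m1 : Num.min (d / 2) t0 <= d / 2 by rewrite ge_min lexx.
have m2 : Num.min (d / 2) t0 <= t0 by rewrite ge_min lexx orbT.
have m3 : 0 < Num.min (d / 2) t0 by rewrite lt_min t0p divr_gt0.
have Qt : 0 < Q.[t].
  have := Qd t; rewrite /t; have -> : forall x, t0 - x - t0 = - x by move=> x; ring.
  rewrite normrN (gtr0_norm m3) => /(_ ltac:(lra)); rewrite ltr_norml; lra.
have := Ymin t; rewrite in_itv /= => /(_ ltac:(rewrite /t; apply/andP; split; lra)).
have := congr1 (fun p => p.[t]) YQ.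
rewrite /= hornerD hornerN hornerC hornerM hornerXsubC => E.
have : Q.[t] * (t - t0) < 0 by rewrite pmulr_rlt0 // /t; lra.
lra.
Qed.

(** The [m]-th moment of the distribution with density
    [delta * t ^ (delta - 1)] on [0, 1]. *)
Definition beta_moment (delta : R) (m : nat) : R[i] := (delta / (delta + m%:R))%:C%C.

Lemma Re_sum (I : Type) (r : seq I) (P : pred I) (F : I -> R[i]) :
  complex.Re (\sum_(i <- r | P i) F i) = \sum_(i <- r | P i) complex.Re (F i).
Proof. by elim/big_rec2: _ => // i x y _ <-; rewrite ReD. Qed.

(** Rotate the value of the functional to the positive axis and apply
    [beta_ge0] to [M - Re H]. *)
Lemma mean_beta_bound delta (H : {poly R[i]}) M : 0 < delta ->
  (forall t, 0 <= t <= 1 -> nc H.[t%:C%C] <= M) ->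
  nc (mean (beta_moment delta) H) <= M.
Proof.
move=> d0 HM; set L := mean _ H.
have M0 : 0 <= M by apply: le_trans (nc_ge0 _) (HM 0 _); rewrite lexx ler01.
have [->|L0] := eqVneq L 0; first by rewrite nc0.
have ncL : 0 < nc L by rewrite nc_gt0.
(* The unimodular number for which [c * L = |L|]. *)
pose c : R[i] := L^* / (nc L)%:C%C.
have ncc : nc c = 1.
  by rewrite /c ncM nc_conj ncV nc_real ger0_norm ?nc_ge0 // divff // gt_eqF.
have cL : complex.Re (c * L) = nc L.
  have -> : c * L = ((nc L)^-1)%:C%C * (L * L^*) by rewrite /c fmorphV; ring.
  rewrite Re_real.
  have -> : complex.Re (L * L^*) = nc L ^+ 2.
    by rewrite sqr_nc; case: (L) => a b /=; ring.
  by rewrite expr2 mulKf // gt_eqF.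
pose h := M%:P - \poly_(j < size H) complex.Re (c * H`_j).
have ht t : h.[t] = M - complex.Re (c * H.[t%:C%C]).
  rewrite /h hornerD hornerN hornerC horner_poly; congr (_ - _).
  rewrite horner_coef mulr_sumr Re_sum; apply: eq_bigr => j _.
  rewrite -rmorphXn mulrA [_ * (_)%:C%C]mulrC Re_real; ring.
have : 0 <= \sum_(j < size h) h`_j * (delta / (delta + j%:R)).
  apply: beta_ge0 => // t t01; rewrite ht subr_ge0.
  by apply: le_trans (Re_le _) _; rewrite ncM ncc mul1r HM.
pose N := maxn (size h) (maxn (size H) 1).
have -> : \sum_(j < size h) h`_j * (delta / (delta + j%:R)) =
          \sum_(j < N) h`_j * (delta / (delta + j%:R)).
  rewrite (big_ord_widen N (fun j => h`_j * (delta / (delta + j%:R)))) ?leq_maxl //.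
  rewrite big_mkcond; apply: eq_bigr => j _; case: ltnP => // /leq_sizeP/(_ j (leqnn _)) ->.
  by rewrite mul0r.
have -> : \sum_(j < N) h`_j * (delta / (delta + j%:R)) = M - nc L.
  under eq_bigr do rewrite /h coefB coefC coef_poly mulrBl.
  rewrite sumrB; congr (_ - _).
    have N0 : (0 < N)%N by rewrite /N !leq_max !orbT.
    rewrite (bigD1 (Ordinal N0)) //= big1 => [|i].
      by rewrite addr0 mulr0n addr0 divff ?mulr1 // gt_eqF.
    by rewrite -val_eqE /= => /negPf ->; rewrite mul0r.
  rewrite -cL /L (@mean_widen _ _ _ N) ?leq_max ?leqnn ?orbT // mulr_sumr Re_sum.
  apply: eq_bigr => j _; rewrite /beta_moment [in RHS]mulrA [in RHS]mulrC Re_real [LHS]mulrC.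
  case: ltnP => // /leq_sizeP/(_ j (leqnn _)) ->.
  by rewrite !mulr0.
by rewrite subr_ge0.
Qed.

Lemma mean_beta_monomial delta i m : 0 < delta ->
  mean (beta_moment delta) ((1 - 'X) ^+ i * 'X^m) =
  (delta / (delta + m%:R) *
     \prod_(l < i) (l.+1%:R / (delta + m%:R + l.+1%:R)))%:C%C.
Proof.
move=> d0; have dp (a : R) : 0 <= a -> delta + a != 0 by move=> a0; apply: lt0r_neq0; lra.
have shift i' m' : \prod_(l < i') (l.+1%:R / (delta + m'.+1%:R + l.+1%:R)) =
   \prod_(l < i') (l.+1%:R / (delta + m'%:R + l.+1%:R)) *
     ((delta + m'%:R + 1) / (delta + m'%:R + i'%:R + 1)) :> R.
  elim: i' => [|i' IH]; first by rewrite !big_ord0 addr0 divff ?mulr1 // -addrA dp.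
  rewrite !big_ord_recr /= IH -!natr1; field.
  by rewrite -!addrA !dp ?addr_ge0.
elim: i m => [|i IH] m; first by rewrite big_ord0 mulr1 expr0 mul1r meanXn.
rewrite exprSr -mulrA mulrBl mul1r -exprS mulrBr linearB /= !IH -rmorphB; congr (_%:C%C).
rewrite shift big_ord_recr /= -!natr1; field.
by rewrite -!addrA !dp ?addr_ge0.
Qed.

End Beta.

(** * Block recursions and their probabilistic solution *)

Section Blocks.
Variable R : realType.
Local Notation nc := (@Normc.normc R).
Implicit Types (r : nat -> R) (u nu b : nat -> R[i]).

(** If independent trials succeed with probability [1 - r l] at time [l],
    this is the probability that the last success before time [j] is at [m]. *)
Definition block_weight r j m : R := (1 - r m) * \prod_(m.+1 <= l < j) r l.

Lemma block_weight_last r j : block_weight r j.+1 j = 1 - r j.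
Proof. by rewrite /block_weight big_geq // mulr1. Qed.

Lemma block_weightS r j m : (m < j)%N ->
  block_weight r j.+1 m = r j * block_weight r j m.
Proof. by move=> mj; rewrite /block_weight big_nat_recr //=; ring. Qed.

(** As [r 0 = 0], the trial at time [0] always succeeds. *)
Lemma sum_block_weight r j : r 0%N = 0 -> \sum_(m < j.+1) block_weight r j.+1 m = 1.
Proof.
move=> r0; elim: j => [|j IH].
  by rewrite big_ord_recr big_ord0 /= block_weight_last r0 subr0 add0r.
rewrite big_ord_recr /= block_weight_last.
under eq_bigr do rewrite block_weightS //.
by rewrite -mulr_sumr IH; ring.
Qed.

Lemma block_weight_ge0 r j m : (m < j)%N ->
  (forall l, (l < j)%N -> 0 <= r l <= 1) -> 0 <= block_weight r j m.
Proof.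
move=> mj r01; rewrite mulr_ge0 ?subr_ge0 //; first by case/andP: (r01 m mj).
rewrite big_nat prodr_ge0 // => l /andP[_ /r01/andP[]] //.
Qed.

Definition blocks r nu u j : R[i] :=
  \sum_(m < j) (block_weight r j m)%:C%C * nu (j - m)%N * u m.

Lemma nc_blocks_le1 r nu u j : (0 < j)%N -> r 0%N = 0 ->
  (forall l, (l < j)%N -> 0 <= r l <= 1) -> (forall i, nc (nu i) <= 1) ->
  (forall m, (m < j)%N -> nc (u m) <= 1) -> nc (blocks r nu u j) <= 1.
Proof.
case: j => // j _ r0 r01 nu1 u1; apply: le_trans (nc_sum _ _ _) _.
rewrite -[leRHS](sum_block_weight j r0); apply: ler_sum => m _.
have w0 := block_weight_ge0 (ltn_ord m) r01.
rewrite !ncM nc_real ger0_norm // -mulrA ler_piMr //.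
by rewrite mulr_ile1 ?nc_ge0 ?u1.
Qed.

(** The value at [j] is stable after [j.+1] iterations of [F] from zero. *)
Lemma strong_recursion (F : nat -> (nat -> R[i]) -> R[i]) :
  (forall j u v, (forall m, (m < j)%N -> u m = v m) -> F j u = F j v) ->
  exists u, forall j, u j = F j u.
Proof.
move=> Fext; pose G (u : nat -> R[i]) j := F j u.
have stable t : forall s j, (j < t)%N -> (t <= s)%N ->
    iter s G (fun=> 0) j = iter t G (fun=> 0) j.
  elim: t => [|t IH] s j //= jt; case: s => // s ts /=.
  apply: Fext => m mj; rewrite (IH s) //; lia.
exists (fun j => iter j.+1 G (fun=> 0) j) => j /=.
by apply: Fext => m mj; apply: (stable m.+1 j m).
Qed.

Lemma blocks_ext r nu j u v : (forall m, (m < j)%N -> u m = v m) ->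
  blocks r nu u j = blocks r nu v j.
Proof. by move=> uv; apply: eq_bigr => m _; rewrite uv. Qed.

Lemma exists_block_solution r nu :
  exists2 b, b 0%N = 1 & forall j, (0 < j)%N -> b j = blocks r nu b j.
Proof.
have [|b bF] := @strong_recursion (fun j u => if j == 0%N then 1 else blocks r nu u j).
  by move=> [|j] u v uv //=; apply: blocks_ext.
by exists b => [|[|j] // _]; rewrite bF.
Qed.

(** With the urn ratios these are the moments of [(1 - T) x + T X'] for
    independent [x], [X'] with moments [nu], [u] and a beta variable [T]. *)
Definition stick r nu u j : R[i] :=
  \sum_(m < j.+1) (block_weight r j.+1 m)%:C%C * nu (j - m)%N * u m.

(** This turns the implicit stick-breaking equation into the recursion
    [blocks], which only uses smaller indices. *)
Lemma stick_blocks r nu u j : nu 0%N = 1 ->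
  stick r nu u j = (r j)%:C%C * blocks r nu u j + (1 - r j)%:C%C * u j.
Proof.
move=> nu0; rewrite /stick big_ord_recr /= block_weight_last subnn nu0 mulr1.
congr (_ + _); rewrite mulr_sumr; apply: eq_bigr => m _.
by rewrite block_weightS // rmorphM; ring.
Qed.

Lemma block_solution_stick r nu b : nu 0%N = 1 -> r 0%N = 0 -> b 0%N = 1 ->
  (forall j, (0 < j)%N -> b j = blocks r nu b j) -> forall j, stick r nu b j = b j.
Proof.
move=> nu0 r0 b0 bE j; rewrite stick_blocks //; case: (posnP j) => [->|j0].
  by rewrite r0 subr0 mul0r add0r mul1r.
by rewrite -bE // -mulrDl -rmorphD addrC subrK mul1r.
Qed.

(** In the Polya urn of total weight [delta] this is the probability that a
    draw after [l] draws repeats an earlier one. *)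
Definition urn_ratio (delta : R) l : R := l%:R / (delta + l%:R).

Lemma urn_ratio0 delta : urn_ratio delta 0 = 0.
Proof. by rewrite /urn_ratio mul0r. Qed.

Lemma urn_ratio01 delta l : 0 < delta -> 0 <= urn_ratio delta l <= 1.
Proof.
move=> d0; have l0 : 0 <= l%:R :> R by [].
have dl : 0 < delta + l%:R by lra.
by rewrite divr_ge0 ?(ltW dl) //= ler_pdivrMr // mul1r; lra.
Qed.

(** The weights of the urn are the binomially weighted beta moments, which
    makes stick-breaking an average over [T]. *)
Lemma block_weight_beta delta j m : 0 < delta -> (m <= j)%N ->
  (block_weight (urn_ratio delta) j.+1 m)%:C%C =
  'C(j, m)%:R * mean (beta_moment delta) ((1 - 'X) ^+ (j - m) * 'X^m).
Proof.
move=> d0 mj; rewrite mean_beta_monomial // -(rmorph_nat (real_complex R)) -rmorphM.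
congr (_%:C%C); rewrite -(subnK mj) addnK; elim: (j - m)%N => {j mj} [|i IH].
  rewrite add0n binn mul1r big_ord0 mulr1 block_weight_last /urn_ratio; field.
  by apply: lt0r_neq0; rewrite ltr_wpDr.
rewrite addSn block_weightS ?ltnS ?leq_addl // IH big_ord_recr /= /urn_ratio.
have := mul_bin_down (i + m).+1 m; rewrite /= subSn ?leq_addl // addnK.
move=> /(congr1 (fun k => k%:R : R)); rewrite !natrM => E.
have -> : delta + (i + m).+1%:R = delta + m%:R + i.+1%:R.
  by rewrite -addSn natrD; ring.
set p := \prod_(_ < _) _; set w := delta + m%:R + i.+1%:R.
transitivity ((i + m).+1%:R * 'C(i + m, m)%:R * (w^-1 * (delta / (delta + m%:R) * p))).
  by ring.
by rewrite E; ring.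
Qed.

(** Fix [T = t] and then [x]: the values [(1 - t) x + t y] stay in the disk, so
    the bound [M] on [P] survives the averages over [y], then [x], then [t]. *)
Lemma stick_contractive delta nu u : 0 < delta ->
  contractive nu -> contractive u -> contractive (stick (urn_ratio delta) nu u).
Proof.
move=> d0 cnu cu P M PM.
pose c j m : R[i] := P`_j * 'C(j, m)%:R.
pose H : {poly R[i]} := \sum_(j < size P) \sum_(m < j.+1)
  (c j m * nu (j - m)%N * u m) *: ((1 - 'X) ^+ (j - m) * 'X^m).
have -> : mean (stick (urn_ratio delta) nu u) P = mean (beta_moment delta) H.
  rewrite /H linear_sum; apply: eq_bigr => j _; rewrite linear_sum mulr_sumr.
  apply: eq_bigr => m _; rewrite linearZ /= block_weight_beta //; first by rewrite /c; ring.
  by rewrite -ltnS.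
apply: mean_beta_bound => // t /andP[t0 t1].
pose Q : {poly R[i]} := \sum_(j < size P) \sum_(m < j.+1)
  (c j m * (1 - t%:C%C) ^+ (j - m) * t%:C%C ^+ m * u m) *: 'X^(j - m).
have -> : H.[t%:C%C] = mean nu Q.
  rewrite /H /Q horner_sum linear_sum; apply: eq_bigr => j _.
  rewrite horner_sum linear_sum; apply: eq_bigr => m _.
  rewrite linearZ /= meanXn hornerZ hornerM horner_exp hornerD hornerN hornerC hornerX.
  by rewrite hornerXn; ring.
apply: cnu => x x1.
pose S : {poly R[i]} := \sum_(j < size P) \sum_(m < j.+1)
  (c j m * (1 - t%:C%C) ^+ (j - m) * t%:C%C ^+ m * x ^+ (j - m)) *: 'X^m.
have -> : Q.[x] = mean u S.
  rewrite /S /Q horner_sum linear_sum; apply: eq_bigr => j _.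
  rewrite horner_sum linear_sum; apply: eq_bigr => m _.
  by rewrite linearZ /= meanXn hornerZ hornerXn; ring.
apply: cu => y y1.
have -> : S.[y] = P.[(1 - t%:C%C) * x + t%:C%C * y].
  rewrite [RHS]horner_coef /S horner_sum; apply: eq_bigr => j _.
  rewrite exprDn horner_sum mulr_sumr; apply: eq_bigr => m _.
  by rewrite hornerZ hornerXn !exprMn -mulr_natr /c; ring.
apply: PM; apply: le_trans (ncD _ _) _; rewrite !ncM.
have -> : 1 - t%:C%C = (1 - t)%:C%C :> R[i] by rewrite rmorphB rmorph1.
rewrite !nc_real !ger0_norm ?subr_ge0 //.
by have := nc_ge0 x; have := nc_ge0 y; nra.
Qed.

Lemma contractive_lim b :
  (forall N e, 0 < e -> exists2 u, contractive u &
     forall j, (j < N)%N -> nc (b j - u j) <= e) -> contractive b.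
Proof.
move=> Hb P M PM; pose S := \sum_(j < size P) nc P`_j.
have S0 : 0 <= S by apply: sumr_ge0 => *; apply: nc_ge0.
apply: (le_of_eps S0) => e /andP[e0 _].
have [u cu bu] := Hb (size P) e e0.
have := ncD (mean b P - mean u P) (mean u P); rewrite subrK.
have := cu _ _ PM; have := mean_lipschitz (leqnn _) bu; rewrite -/S.
lra.
Qed.

Lemma origin_contractive : contractive (fun j => (j == 0%N)%:R : R[i]).
Proof.
move=> P M PM; have -> : mean (fun j => (j == 0%N)%:R) P = P.[0].
  rewrite horner_coef; apply: eq_bigr => j _; congr (_ * _).
  by case: (val j) => [|k]; rewrite ?expr0 // exprS mul0r.
by apply: PM; rewrite nc0.
Qed.

(** The fixed point equation is triangular, and its diagonal entry at an
    index [j > 0] is [delta / (delta + j) <= theta < 1].  The geometric growth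
    in [j] of the constant absorbs the entries below the diagonal. *)
Lemma iter_stick_cvg delta nu b t j (theta := delta / (delta + 1)) :
  0 < delta -> nu 0%N = 1 -> (forall i, nc (nu i) <= 1) ->
  b 0%N = 1 -> (forall j, (0 < j)%N -> b j = blocks (urn_ratio delta) nu b j) ->
  nc (b j - iter t (stick (urn_ratio delta) nu) (fun j => (j == 0%N)%:R) j) <=
  2 * (2 / (1 - theta)) ^+ j * ((1 + theta) / 2) ^+ t.
Proof.
move=> d0 nu0 nu1 b0 bE; set r := urn_ratio delta.
have r01 l : 0 <= r l <= 1 by exact: urn_ratio01.
have r0 : r 0%N = 0 by exact: urn_ratio0.
have th1 : 0 < theta < 1.
  rewrite /theta divr_gt0 ?addr_gt0 //= ltr_pdivrMr ?addr_gt0 //; lra.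
have b1 i : nc (b i) <= 1.
  elim/ltn_ind: i => -[|i] IH; first by rewrite b0 nc1.
  by rewrite bE // nc_blocks_le1.
set kappa := 2 / (1 - theta); have k1 : 1 <= kappa.
  by rewrite ler_pdivlMr; lra.
set tau := (1 + theta) / 2.
elim: t j => [|t IH] j.
  rewrite expr0 mulr1; have := ncD (b j) (- (j == 0%N)%:R); rewrite ncN /=.
  have : nc (j == 0%N)%:R <= 1 by case: (j == 0%N); rewrite ?nc0 ?nc1.
  have := b1 j; have : 1 <= kappa ^+ j by rewrite exprn_ege1.
  lra.
rewrite iterS -[b j](block_solution_stick nu0 r0 b0 bE); set u := iter t _ _.
have [->|j0] := posnP j.
  rewrite !stick_blocks // r0 !mul0r !add0r subr0 !mul1r.
  have -> : u 0%N = 1.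
    rewrite /u; elim: t {IH u} => //= t IH.
    by rewrite stick_blocks // IH r0 mul0r add0r subr0 mul1r.
  by rewrite b0 subrr nc0 !mulr_ge0 ?exprn_ge0 // /tau; lra.
have -> : stick r nu b j - stick r nu u j =
  \sum_(m < j.+1) (block_weight r j.+1 m)%:C%C * nu (j - m)%N * (b m - u m).
  by rewrite -sumrB; apply: eq_bigr => m _; rewrite mulrBr.
apply: le_trans (nc_sum _ _ _) _.
have w0 m : (m < j.+1)%N -> 0 <= block_weight r j.+1 m.
  by move=> mj; apply: block_weight_ge0.
have step : \sum_(m < j.+1) nc ((block_weight r j.+1 m)%:C%C * nu (j - m)%N * (b m - u m))
   <= \sum_(m < j.+1) block_weight r j.+1 m * (2 * kappa ^+ m * tau ^+ t).
  apply: ler_sum => m _; rewrite !ncM nc_real ger0_norm ?w0 // -mulrA.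
  rewrite ler_wpM2l ?w0 // -[leRHS]mul1r ler_pM ?nc_ge0 //; exact: IH.
apply: le_trans step _.
have tau0 : 0 <= tau ^+ t by rewrite exprn_ge0 // /tau; lra.
case: j j0 w0 => // j _ w0.
rewrite big_ord_recr /= block_weight_last.
have step : \sum_(m < j.+1) block_weight r j.+2 m * (2 * kappa ^+ m * tau ^+ t)
    <= r j.+1 * (2 * kappa ^+ j * tau ^+ t).
  rewrite -[r j.+1 in leRHS]mulr1 -[X in _ * X * _](sum_block_weight j r0) mulr_sumr mulr_suml.
  apply: ler_sum => m _; rewrite -block_weightS // ler_wpM2l ?w0 //.
    by rewrite ltnW // ltnS.
  by rewrite ler_wpM2r // ler_wpM2l //; apply: ler_weXn2l => //; rewrite -ltnS.
apply: le_trans (lerD step (lexx _)) _.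
have rj : 1 - r j.+1 <= theta.
  rewrite /r /urn_ratio /theta -subr_ge0.
  have -> : delta / (delta + 1) - (1 - j.+1%:R / (delta + j.+1%:R)) =
     delta * j%:R / ((delta + 1) * (delta + j.+1%:R)).
    rewrite -natr1; field; have : 0 <= j%:R :> R by []; move=> ?.
    by apply/andP; split; apply: lt0r_neq0; lra.
  by rewrite divr_ge0 ?mulr_ge0 ?addr_ge0 // ltW.
have kk : kappa * (1 - theta) = 2 by rewrite /kappa divfK //; lra.
rewrite !exprS; have K0 : 0 <= kappa ^+ j by rewrite exprn_ge0 //; lra.
have /andP[rj0 rj1] := r01 j.+1.
have -> : 2 * (kappa * kappa ^+ j) * (tau * tau ^+ t) =
  2 * (kappa ^+ j * tau ^+ t) * (kappa * tau) by ring.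
have -> : r j.+1 * (2 * kappa ^+ j * tau ^+ t) +
    (1 - r j.+1) * (2 * (kappa * kappa ^+ j) * tau ^+ t) =
  2 * (kappa ^+ j * tau ^+ t) * (r j.+1 + (1 - r j.+1) * kappa) by ring.
rewrite ler_wpM2l ?mulr_ge0 //.
have -> : kappa * tau = kappa * theta + 1 by rewrite /tau; lra.
by nra.
Qed.

(** The solution is the limit of the stick-breaking iteration started at the
    evaluation at the origin, and every iterate is contractive. *)
Theorem block_solution_contractive delta nu b : 0 < delta ->
  nu 0%N = 1 -> contractive nu ->
  b 0%N = 1 -> (forall j, (0 < j)%N -> b j = blocks (urn_ratio delta) nu b j) ->
  contractive b.
Proof.
move=> d0 nu0 cnu b0 bE; apply: contractive_lim => N e e0.
have nu1 i : nc (nu i) <= 1 by apply: contractive_le1.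
pose theta := delta / (delta + 1).
have th1 : 0 < theta < 1.
  rewrite /theta divr_gt0 ?addr_gt0 //= ltr_pdivrMr ?addr_gt0 //; lra.
pose kappa := 2 / (1 - theta); have k1 : 1 <= kappa.
  by rewrite ler_pdivlMr; lra.
have k0 : 0 < 2 * kappa ^+ N by rewrite mulr_gt0 // exprn_gt0 //; lra.
have [||t tL] := @exists_expr_lt R ((1 + theta) / 2) (e / (2 * kappa ^+ N)).
- by apply/andP; split; lra.
- exact: divr_gt0.
exists (iter t (stick (urn_ratio delta) nu) (fun j => (j == 0%N)%:R)).
  elim: t {tL} => [|t IH]; first exact: origin_contractive.
  exact: stick_contractive.
move=> j jN; apply: le_trans (iter_stick_cvg _ _ d0 nu0 nu1 b0 bE) _.
rewrite -/theta -/kappa; move: tL; rewrite ltr_pdivlMr // => /ltW; apply: le_trans.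
rewrite mulrC ler_wpM2l ?exprn_ge0 //; first by lra.
by rewrite ler_wpM2l //; apply: ler_weXn2l => //; exact: ltnW.
Qed.

Lemma prod_close r s e j m : (forall l, (l < j)%N -> 0 <= r l <= 1) ->
  (forall l, (l < j)%N -> 0 <= s l <= 1) ->
  (forall l, (l < j)%N -> `|r l - s l| <= e) -> (m <= j)%N ->
  `|\prod_(m <= l < j) r l - \prod_(m <= l < j) s l| <= (j - m)%:R * e.
Proof.
move=> r01 s01 rs mj.
elim: j mj r01 s01 rs => [|j IH]; first by rewrite leqn0 => /eqP -> *; rewrite !big_geq // subrr normr0 mul0r.
rewrite leq_eqVlt => /orP[/eqP -> *|mj r01 s01 rs].
  by rewrite !big_geq // subrr normr0 subnn mul0r.
rewrite !big_nat_recr //= subSn // -natr1 mulrDl mul1r.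
have {IH} := IH mj (fun l h => r01 l (ltnW h)) (fun l h => s01 l (ltnW h))
  (fun l h => rs l (ltnW h)).
have p01 : 0 <= \prod_(m <= l < j) r l <= 1.
  rewrite big_nat; apply: (big_ind (fun x => 0 <= x <= 1)) => //.
  - by rewrite ler01 lexx.
  - by move=> x y /andP[x0 x1] /andP[y0 y1]; rewrite mulr_ge0 // mulr_ile1.
  - by move=> l /andP[_ lj]; rewrite r01 // ltnW.
have := rs j (ltnSn j); have := s01 j (ltnSn j).
move: (\prod_(_ <= _ < _) r _) (\prod_(_ <= _ < _) s _) p01 => p q p01 sj rsj pq.
have -> : p * r j - q * s j = p * (r j - s j) + (p - q) * s j by ring.
apply: le_trans (ler_normD _ _) _; rewrite !normrM addrC.
have /andP[p0 p1] := p01; have /andP[s0 s1] := sj.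
rewrite [`|p|]ger0_norm // [`|s j|]ger0_norm //.
have := normr_ge0 (r j - s j); have := normr_ge0 (p - q).
nra.
Qed.

Lemma block_weight_close r s e j m : (m < j)%N ->
  (forall l, (l < j)%N -> 0 <= r l <= 1) ->
  (forall l, (l < j)%N -> 0 <= s l <= 1) ->
  (forall l, (l < j)%N -> `|r l - s l| <= e) ->
  `|block_weight r j m - block_weight s j m| <= j%:R * e.
Proof.
move=> mj r01 s01 rs.
have := prod_close r01 s01 rs mj.
have p01 : 0 <= \prod_(m.+1 <= l < j) r l <= 1.
  rewrite big_nat; apply: (big_ind (fun x => 0 <= x <= 1)) => //.
  - by rewrite ler01 lexx.
  - by move=> x y /andP[x0 x1] /andP[y0 y1]; rewrite mulr_ge0 // mulr_ile1.
  - by move=> l /andP[_ lj]; rewrite r01.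
have := rs m mj; have := s01 m mj; rewrite /block_weight.
move: (\prod_(_ <= _ < _) r _) (\prod_(_ <= _ < _) s _) p01 => p q p01 sm rsm pq.
have -> : (1 - r m) * p - (1 - s m) * q = (s m - r m) * p + (p - q) * (1 - s m) by ring.
apply: le_trans (ler_normD _ _) _; rewrite !normrM distrC.
have /andP[p0 p1] := p01; have /andP[s0 s1] := sm.
rewrite [`|p|]ger0_norm // [`|1 - s m|]ger0_norm ?subr_ge0 //.
have e0 : 0 <= e by apply: le_trans rsm.
have : 1 + (j - m.+1)%:R <= j%:R :> R by rewrite nat1r ler_nat; lia.
have := normr_ge0 (r m - s m); have := normr_ge0 (p - q).
nra.
Qed.

(** The block weights are averages of total mass one, so the errors made at
    smaller indices are not amplified but only added. *)
Lemma block_solutions_close r s nu b c e J :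
  r 0%N = 0 -> s 0%N = 0 ->
  (forall l, (l < J)%N -> 0 <= r l <= 1) ->
  (forall l, (l < J)%N -> 0 <= s l <= 1) ->
  (forall l, (l < J)%N -> `|r l - s l| <= e) ->
  (forall i, nc (nu i) <= 1) -> b 0%N = 1 -> c 0%N = 1 ->
  (forall j, (0 < j <= J)%N -> b j = blocks r nu b j) ->
  (forall j, (0 < j <= J)%N -> c j = blocks s nu c j) ->
  forall j, (j <= J)%N -> nc (b j - c j) <= j%:R ^+ 3 * e.
Proof.
move=> r0 s0 r01 s01 rs nu1 b0 c0 bE cE.
have b1 j : (j <= J)%N -> nc (b j) <= 1.
  elim/ltn_ind: j => -[|j] IH jJ; first by rewrite b0 nc1.
  rewrite bE // nc_blocks_le1 // => [l lj|m mj]; first by apply: r01; lia.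
  by apply: IH => //; lia.
elim/ltn_ind => -[|j] IH jJ; first by rewrite b0 c0 subrr nc0 expr0n mul0r.
have e0 : 0 <= e by apply: le_trans (normr_ge0 _) (rs 0%N (leq_ltn_trans (leq0n j) jJ)).
have r01j l : (l < j.+1)%N -> 0 <= r l <= 1 by move=> ?; apply: r01; lia.
have s01j l : (l < j.+1)%N -> 0 <= s l <= 1 by move=> ?; apply: s01; lia.
rewrite bE // cE // /blocks -sumrB.
apply: le_trans (nc_sum _ _ _) _.
have step (m : 'I_j.+1) : nc ((block_weight r j.+1 m)%:C%C * nu (j.+1 - m)%N * b m -
    (block_weight s j.+1 m)%:C%C * nu (j.+1 - m)%N * c m) <=
    j.+1%:R * e + block_weight s j.+1 m * (j%:R ^+ 3 * e).
  have -> : (block_weight r j.+1 m)%:C%C * nu (j.+1 - m)%N * b m -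
    (block_weight s j.+1 m)%:C%C * nu (j.+1 - m)%N * c m =
    (block_weight r j.+1 m - block_weight s j.+1 m)%:C%C * (nu (j.+1 - m)%N * b m) +
    (block_weight s j.+1 m)%:C%C * (nu (j.+1 - m)%N * (b m - c m)).
    by rewrite rmorphB; ring.
  have mj : (m <= j)%N by rewrite -ltnS.
  have bm := b1 m (leq_trans mj (ltnW jJ)).
  apply: le_trans (ncD _ _) _; rewrite !ncM !nc_real lerD //.
    apply: le_trans (_ : `|block_weight r j.+1 m - block_weight s j.+1 m| <= _).
      by rewrite ler_piMr // mulr_ile1 ?nc_ge0.
    by apply: block_weight_close => // l lj; apply: rs; lia.
  rewrite ger0_norm ?block_weight_ge0 // ler_wpM2l ?block_weight_ge0 //.
  apply: le_trans (_ : nc (b m - c m) <= _); first by rewrite ler_piMl ?nc_ge0.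
  apply: le_trans (IH m (ltn_ord m) (leq_trans mj (ltnW jJ))) _.
  by rewrite ler_wpM2r // lerXn2r ?nnegrE // ler_nat.
apply: le_trans (ler_sum _ (fun m _ => step m)) _.
rewrite big_split /= sumr_const card_ord -mulr_suml sum_block_weight // mul1r.
rewrite -[_ *+ j.+1]mulr_natr -!natr1 [_ * e]mulrC.
rewrite -subr_ge0; set x := j%:R.
have -> : (x + 1) ^+ 3 * e - (e * (x + 1) * (x + 1) + x ^+ 3 * e) =
  (2 * x ^+ 2 + x) * e by ring.
by rewrite mulr_ge0 // addr_ge0 // mulr_ge0 // exprn_ge0.
Qed.

End Blocks.

(** * Sine quotients against urn probabilities *)

Section SineRatio.
Variable R : realType.
Implicit Types x y a : R.

Lemma sin_MVT x : 0 < x -> exists2 c, 0 < c < x & sin x = cos c * x.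
Proof.
move=> x0; have [|c] := @MVT R sin cos 0 x x0 (fun c _ => is_derive_sin c).
  by apply: continuous_subspaceT; exact: continuous_sin.
by rewrite in_itv /= sin0 !subr0 => cx E; exists c.
Qed.

Lemma sin_le x : 0 <= x -> sin x <= x.
Proof.
rewrite le_eqVlt => /orP[/eqP <-|x0]; first by rewrite sin0.
by have [c _ ->] := sin_MVT x0; rewrite ler_piMl ?cos_le1 // ltW.
Qed.

Lemma sin_ge_cubic x : 0 <= x <= 2 -> x * (1 - x ^+ 2 / 2) <= sin x.
Proof.
case/andP; rewrite le_eqVlt => /orP[/eqP <-|x0] x2; first by rewrite mul0r sin0.
have [c /andP[c0 cx] ->] := sin_MVT x0; rewrite mulrC ler_wpM2r ?(ltW x0) //.
have -> : c = (c / 2) *+ 2 by rewrite -mulr_natr divfK.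
rewrite cos_mulr2n cos2sin2.
have s1 : sin (c / 2) <= c / 2 by apply: sin_le; lra.
have s0 : 0 <= sin (c / 2).
  by apply: sin_ge0_pi; have := pi_ge2 R; move=> ?; apply/andP; split; lra.
nra.
Qed.

Lemma sin_ge_quadratic x : 0 <= x -> x - x ^+ 2 <= sin x.
Proof.
move=> x0; have [x2|x2] := leP x 2.
  have := @sin_ge_cubic x; rewrite x0 x2 => /(_ isT); nra.
have := sin_geN1 x; nra.
Qed.

Lemma sin_ge_quarter x : 0 <= x <= pi / 2 -> x / 4 <= sin x.
Proof.
have p2 := @pihalf_lt2 R; have p1 := @pihalf_ge1 R.
move=> /andP[x0 xp]; have [x1|x1] := leP x 1.
  have := @sin_ge_cubic x; rewrite x0 => /(_ ltac:(lra)); nra.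
have : sin 1 < sin x by rewrite ltr_sin // in_itv /=; apply/andP; split; lra.
have := @sin_ge_cubic 1 => /(_ ltac:(lra)); lra.
Qed.

Lemma sin_le_sin a x : 0 <= a <= x -> a + x <= pi -> sin a <= sin x.
Proof.
move=> /andP[a0 ax] axp; pose m := (x + a) / 2; pose d := (x - a) / 2.
have -> : x = m + d by rewrite /m /d; field.
have -> : a = m - d by rewrite /m /d; field.
rewrite !sinD cosN sinN.
have : 0 <= cos m by apply: cos_ge0_pihalf; rewrite /m; apply/andP; split; lra.
have : 0 <= sin d by apply: sin_ge0_pi; rewrite /d; apply/andP; split; lra.
nra.
Qed.

(** If [y <= 1], both quotients come from sine being close to the identity.
    If [y > 1], both are small since [a] is small and [sin y] is
    not small compared with [pi - y]. *)
Lemma sin_ratio_close a y (e : R) : 0 <= a < y -> y < pi -> 4 * a <= e ->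
  4 * a <= e * (pi - y) ->
  `|sin a / sin y - a / y| <= e.
Proof.
move=> /andP[a0 ay] yp ae1 ae2; have y0 : 0 < y by lra.
have sy0 : 0 < sin y by rewrite sin_gt0_pi // y0.
have sa1 := sin_le a0; have sa2 := sin_ge_quadratic a0.
have sy1 := sin_le (ltW y0); have sy2 := sin_ge_quadratic (ltW y0).
have [y1|y1] := leP y 1.
  have yh : y / 2 <= sin y.
    have : 0 <= y * (1 - y ^+ 2) by rewrite mulr_ge0 ?(ltW y0) // subr_ge0 expr_le1 // ltW.
    have /sin_ge_cubic : 0 <= y <= 2 by lra.
    by move=> h1 h2; nra.
  have -> : sin a / sin y - a / y = (y * sin a - a * sin y) / (y * sin y).
    by field; rewrite !gt_eqF.
  rewrite normrM normfV ler_pdivrMr ?normr_gt0 ?mulf_neq0 ?gt_eqF //.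
  rewrite [`|y * _|]gtr0_norm ?mulr_gt0 //.
  apply: (@le_trans _ _ (a * y ^+ 2)).
    have h1 : y * sin a <= y * a by rewrite ler_pM2l.
    have h2 : a * sin y <= a * y by rewrite ler_wpM2l.
    have h3 : a * (y - y ^+ 2) <= a * sin y by rewrite ler_wpM2l.
    have h4 : y * (a - a ^+ 2) <= y * sin a by rewrite ler_pM2l.
    have h5 : a * y * a <= a * y * y by apply: ler_wpM2l (ltW ay); rewrite mulr_ge0 ?(ltW y0).
    by rewrite ler_norml; apply/andP; split; lra.
  apply: (@le_trans _ _ (e * (y * (y / 2)))); first by nra.
  by rewrite ler_wpM2l ?ler_wpM2l //; lra.
have sa0 : 0 <= sin a.
  by apply: sin_ge0_pi; apply/andP; split; lra.
have q1 : 0 <= a / y <= e.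
  by rewrite divr_ge0 ?(ltW y0) //= ler_pdivrMr //; nra.
have q2 : 0 <= sin a / sin y <= e.
  rewrite divr_ge0 ?(ltW sy0) //= ler_pdivrMr //.
  have [yp2|yp2] := leP y (pi / 2).
    have := @sin_ge_quarter y; rewrite (ltW y0) yp2 => /(_ isT); nra.
  have -> : sin y = sin (pi - y) by rewrite sinB sinpi cospi; ring.
  have := @sin_ge_quarter (pi - y) => /(_ ltac:(lra)).
  by nra.
by rewrite ler_norml; lra.
Qed.

(** Dividing consecutive weights [E l.-1] and [E l] of the recursion for the
    class leaves this quotient. *)
Definition sine_ratio n (lam : R) l : R :=
  sin (l%:R * lam / 2) / sin ((n%:R - l%:R) * lam / 2).

Lemma sine_ratio0 n lam : sine_ratio n lam 0 = 0.
Proof. by rewrite /sine_ratio !mul0r sin0 mul0r. Qed.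

Lemma sine_ratio01 n lam l : (0 < n)%N -> 0 < lam < 2 * pi / n%:R -> (2 * l <= n)%N ->
  0 <= sine_ratio n lam l <= 1.
Proof.
move=> n0 /andP[lam0 lamn] ln; have n0' : 0 < n%:R :> R by rewrite ltr0n.
rewrite ltr_pdivlMr // in lamn.
have l0 : 0 <= l%:R :> R by [].
have ln' : 2 * l%:R <= n%:R :> R by rewrite -natrM ler_nat.
have lt : l%:R < n%:R :> R by lra.
have x0 : 0 < sin ((n%:R - l%:R) * lam / 2).
  by apply: sin_gt0_pi; apply/andP; split; nra.
have a0 : 0 <= sin (l%:R * lam / 2).
  by apply: sin_ge0_pi; apply/andP; split; nra.
rewrite divr_ge0 ?(ltW x0) //= ler_pdivrMr // mul1r sin_le_sin //; last by nra.
by apply/andP; split; nra.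
Qed.

Lemma sine_ratio_urn n lam l : (0 < n)%N -> 0 < lam < 2 * pi / n%:R -> (2 * l <= n)%N ->
  `|sine_ratio n lam l - urn_ratio (2 * pi / lam - n%:R) l| <= 16 * l%:R / n%:R.
Proof.
move=> n0 /andP[lam0 lamn] ln; have n0' : 0 < n%:R :> R by rewrite ltr0n.
rewrite ltr_pdivlMr // in lamn.
have l0 : 0 <= l%:R :> R by [].
have ln' : 2 * l%:R <= n%:R :> R by rewrite -natrM ler_nat.
have p4 : pi < 4 :> R by have := @pihalf_lt2 R; lra.
pose y := pi - (n%:R - l%:R) * lam / 2.
have -> : sine_ratio n lam l = sin (l%:R * lam / 2) / sin y.
  rewrite /sine_ratio /y sinB sinpi cospi; congr (_ / _); ring.
have y0 : 0 < y by rewrite /y; nra.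
have -> : urn_ratio (2 * pi / lam - n%:R) l = (l%:R * lam / 2) / y.
  have E : (2 * pi / lam - n%:R + l%:R) = 2 * y / lam.
    by rewrite /y; field; rewrite gt_eqF.
  by rewrite /urn_ratio E; field; rewrite !gt_eqF.
have lam2 : l%:R * (lam * n%:R) <= l%:R * (2 * pi) by rewrite ler_wpM2l // ltW.
apply: sin_ratio_close.
- by rewrite /y; apply/andP; split; nra.
- by rewrite /y; nra.
- by rewrite ler_pdivlMr //; nra.
- have -> : pi - y = (n%:R - l%:R) * lam / 2 by rewrite /y; ring.
  rewrite [leRHS]mulrAC ler_pdivlMr //.
  have : 0 <= l%:R * lam * (n%:R - 2 * l%:R) by rewrite !mulr_ge0 ?subr_ge0 ?(ltW lam0).
  nra.
Qed.

End SineRatio.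

(** * Polynomials with separated zeros on the unit circle *)

Section SeparatedZeros.
Variable R : realType.
Local Notation nc := (@Normc.normc R).
Implicit Types (x y z w : R[i]) (s : seq R[i]).

Lemma normc_eq1 z : `|z| = 1 -> nc z = 1.
Proof. by rewrite normE => /complexI. Qed.

Lemma mul_conj_nc z : z * z^* = (nc z ^+ 2)%:C%C.
Proof.
rewrite sqr_nc; case: z => a b; apply/eqP; rewrite eq_complex /=.
by apply/andP; split; apply/eqP; ring.
Qed.

Definition imag (t : R) : R[i] := (0 +i* t)%C.

Lemma expi_shift (a b : R) : expi (a + b) - expi (a - b) = expi a * imag (2 * sin b).
Proof.
apply/eqP; rewrite eq_complex /= !(sinD, cosD, sinN, cosN).
by apply/andP; split; apply/eqP; ring.
Qed.

Definition lagrange_node s x : {poly R[i]} :=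
  \prod_(y <- [seq y <- s | y != x]) ('X - y%:P).

Lemma lagrange_node_eq0 s x y : ((lagrange_node s x).[y] == 0) = (y \in s) && (y != x).
Proof. by rewrite -rootE root_prod_XsubC mem_filter andbC. Qed.

Lemma lagrange_interpolation s (H : {poly R[i]}) w : uniq s -> (size H <= size s)%N ->
  H.[w] = \sum_(x <- s) H.[x] / (lagrange_node s x).[x] * (lagrange_node s x).[w].
Proof.
move=> us Hs; set L := lagrange_node s.
have Lx x : (L x).[x] != 0 by rewrite lagrange_node_eq0 eqxx andbF.
have szL x : x \in s -> size (L x) = size s.
  move=> xs; rewrite /L /lagrange_node size_prod_XsubC size_filter.
  rewrite -(count_predC (pred1 x)) count_uniq_mem // xs add1n.
  by congr _.+1; apply: eq_count => y.
pose K := \sum_(x <- s) (H.[x] / (L x).[x]) *: L x.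
have KE z : K.[z] = \sum_(x <- s) H.[x] / (L x).[x] * (L x).[z].
  by rewrite horner_sum; apply: eq_bigr => x _; rewrite hornerZ.
rewrite -KE; congr (_.[w]); apply/eqP; rewrite -subr_eq0; apply/eqP.
apply: (roots_geq_poly_eq0 (rs := s)) => //.
  apply/allP => x xs; rewrite rootE hornerD hornerN KE (bigD1_seq x) //= divfK //.
  rewrite big1_seq ?addr0 ?subrr // => y /andP[yx ys].
  by have /eqP -> : (L y).[x] == 0; rewrite ?mulr0 // lagrange_node_eq0 xs eq_sym.
apply: leq_trans (size_polyD _ _) _; rewrite size_polyN geq_max Hs /=.
apply: leq_trans (size_sum _ _ _) _; rewrite big_seq.
by apply/bigmax_leqP_seq => x xs _; rewrite -(szL x xs) size_scale_leq.
Qed.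

(** With [x = expi a] and [y = expi b], [rho] is the quotient of
    [sin ((a - b + lam) / 2)] by [sin ((a - b) / 2)].  It is positive exactly
    when rotating [x] by [lam] does not carry it across [y]. *)
Lemma separated_ratio x y (lam : R) : nc x = 1 -> nc y = 1 -> 0 < lam < pi ->
  complex.Re (x * y^*) < cos lam ->
  exists2 rho : R, 0 < rho &
    expi lam * x - y = expi (lam / 2) * rho%:C%C * (x - y).
Proof.
move=> x1 y1 /andP[lam0 lampi]; set t := x * y^*.
have nt : nc t = 1 by rewrite ncM nc_conj x1 y1 mulr1.
have xt : x = t * y by rewrite /t -mulrA [y^* * y]mulrC mul_conj_nc y1 expr1n mulr1.
pose c := cos (lam / 2); pose s := sin (lam / 2).
have lam2 : lam = lam / 2 + lam / 2 by field.
have c0 : 0 < c by apply: cos_gt0_pihalf; apply/andP; split; lra.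
have cs : c ^+ 2 + s ^+ 2 = 1 by exact: cos2Dsin2.
have -> : cos lam = c ^+ 2 - s ^+ 2 by rewrite [in LHS]lam2 cosD !expr2.
have := sqr_nc t; rewrite nt expr1n.
move: xt; case: t {nt} => p q /= xt pq pc.
have p1 : p < 1 by nra.
exists (c + s * q / (1 - p)).
  have -> : c + s * q / (1 - p) = (c * (1 - p) + s * q) / (1 - p).
    by field; rewrite gt_eqF // subr_gt0.
  rewrite divr_gt0 ?subr_gt0 // ltNge; apply/negP => neg.
  have h1 : (c * (1 - p)) ^+ 2 <= (s * q) ^+ 2.
    have h0 : 0 < c * (1 - p) by rewrite mulr_gt0 ?subr_gt0.
    rewrite -[leRHS]sqrrN lerXn2r ?nnegrE; lra.
  have q2 : q ^+ 2 = (1 - p) * (1 + p) by lra.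
  have h2 : (s * q) ^+ 2 = (1 - p) * (s ^+ 2 * (1 + p)) by rewrite exprMn q2; ring.
  have h3 : (c * (1 - p)) ^+ 2 = (1 - p) * (c ^+ 2 * (1 - p)) by ring.
  move: h1; rewrite h2 h3 ler_pM2l ?subr_gt0 //.
  nra.
rewrite [in expi lam]lam2 expiD xt.
suff E : expi (lam / 2) * (p +i* q)%C - expi (- (lam / 2)) =
    (c + s * q / (1 - p))%:C%C * ((p +i* q)%C - 1).
  have e1 : expi (lam / 2) * expi (- (lam / 2)) = 1 :> R[i] by rewrite -expiD subrr expi0.
  transitivity (expi (lam / 2) * y * (expi (lam / 2) * (p +i* q)%C - expi (- (lam / 2)))).
    by rewrite mulrBr [_ * y * expi _]mulrAC e1; ring.
  by rewrite E; ring.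
apply/eqP; rewrite eq_complex /= cosN sinN -/c -/s.
have np : 1 - p != 0 by rewrite gt_eqF // subr_gt0.
apply/andP; split; apply/eqP; first by field.
have -> : q - 0 = q by ring.
have q2 : s * q / (1 - p) * q = s * (1 + p).
  have -> : s * q / (1 - p) * q = s * q ^+ 2 / (1 - p) by ring.
  have -> : q ^+ 2 = (1 - p) * (1 + p) by lra.
  by field.
by rewrite mulrDl q2; ring.
Qed.

Lemma Re_half_plane w x : nc x = 1 -> w != x ->
  complex.Im (imag 1 * x / (w - x)) =
  (nc w ^+ 2 - 1) / (2 * nc (w - x) ^+ 2) - 2^-1.
Proof.
move=> x1 wx; have d0 : nc (w - x) != 0 by rewrite nc_eq0 subr_eq0.
have E : imag 1 * x / (w - x) = ((nc (w - x) ^+ 2)^-1)%:C%C * (imag 1 * x * (w - x)^*).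
  have wx0 : w - x != 0 by rewrite subr_eq0.
  have wxc0 : (w - x)^* != 0 by rewrite conjC_eq0.
  rewrite fmorphV /= -mul_conj_nc; move: wx0 wxc0; move: (w - x) => d.
  by move: d^* => dc d_neq0 dc_neq0; field; rewrite dc_neq0.
rewrite E Im_real; apply: (mulfI (expf_neq0 2 d0)).
rewrite mulrA mulfV ?expf_neq0 // mul1r mulrBr.
have -> : nc (w - x) ^+ 2 * ((nc w ^+ 2 - 1) / (2 * nc (w - x) ^+ 2)) =
  (nc w ^+ 2 - 1) / 2 by field.
have := sqr_nc x; rewrite x1 expr1n !sqr_nc.
by case: (w) => a b; case: (x) => c d /= x2; lra.
Qed.

Lemma prod_XsubC_node s x : uniq s -> x \in s ->
  \prod_(y <- s) ('X - y%:P) = ('X - x%:P) * lagrange_node s x.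
Proof. by move=> us xs; rewrite (bigD1_seq x) //= /lagrange_node big_filter. Qed.

(** The product of the positive factors of [separated_ratio] over the other
    zeros. *)
Lemma node_rotation s x (lam : R) : {in s, forall y, nc y = 1} -> uniq s -> x \in s ->
  {in s, forall y, y != x -> 0 < lam < pi /\ complex.Re (x * y^*) < cos lam} ->
  exists2 rho : R, 0 < rho & (lagrange_node s x).[expi lam * x] =
    expi ((size s)%:R * (lam / 2) - lam / 2) * rho%:C%C * (lagrange_node s x).[x].
Proof.
move=> s1 us xs sep; set r := [seq y <- s | y != x].
have szr : size s = (size r).+1.
  rewrite size_filter -(count_predC (pred1 x)) count_uniq_mem // xs add1n.
  by congr _.+1; apply: eq_count.
have -> : (size s)%:R * (lam / 2) - lam / 2 = (size r)%:R * (lam / 2) :> R.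
  by rewrite szr -natr1; ring.
rewrite /lagrange_node -/r.
have : {subset r <= [pred y | (y != x) && (y \in s)]} by move=> y; rewrite mem_filter.
elim: r {szr} => [|y r IH] rs.
  by exists 1 => //; rewrite big_nil !hornerC /= mul0r expi0 rmorph1 !mul1r.
have [rho rho0 E] := IH (fun z zr => rs z (mem_behead (s := y :: r) zr)).
have /andP[yx ys] := rs y (mem_head _ _).
have [lam0 xy] := sep y ys yx.
have [rho' rho'0 E'] := separated_ratio (s1 x xs) (s1 y ys) lam0 xy.
exists (rho' * rho); first exact: mulr_gt0.
have -> : (size (y :: r))%:R * (lam / 2) = lam / 2 + (size r)%:R * (lam / 2).
  by rewrite /= -nat1r; ring.
by rewrite big_cons !hornerM !hornerXsubC E E' expiD rmorphM /=; ring.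
Qed.

(** Partial fractions: the numerator minus a multiple of the denominator has
    smaller degree and is interpolated at the zeros. *)
Lemma rotation_quotient s (lam : R) : {in s, forall y, nc y = 1} -> uniq s ->
  {in s &, forall x y, y != x -> 0 < lam < pi /\ complex.Re (x * y^*) < cos lam} ->
  0 < sin (lam / 2) ->
  exists2 sigma : R[i] -> R, {in s, forall x, 0 < sigma x} &
  forall w, w \notin s ->
    expi (- ((size s)%:R * lam / 2)) * ((\prod_(y <- s) ('X - y%:P)).[expi lam * w] /
      (\prod_(y <- s) ('X - y%:P)).[w]) =
    expi ((size s)%:R * lam / 2) + \sum_(x <- s) (sigma x)%:C%C * (imag 1 * x / (w - x)).
Proof.
move=> s1 us sep sl; set P := \prod_(y <- s) _; set N := (size s)%:R * lam / 2.
have PL x : x \in s -> P = ('X - x%:P) * lagrange_node s x by exact: prod_XsubC_node.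
have coefE x : exists sg : R, x \in s -> 0 < sg /\
    P.[expi lam * x] = expi N * (sg%:C%C * (imag 1 * x)) * (lagrange_node s x).[x].
  have [xs|] := boolP (x \in s); last by exists 0.
  have [rho rho0 E] := node_rotation s1 us xs (fun y ys => sep x y xs ys).
  exists (2 * sin (lam / 2) * rho) => _; rewrite !mulr_gt0 //; split=> //.
  rewrite (PL x xs) hornerM hornerXsubC E.
  have -> : expi lam * x - x = expi (lam / 2) * imag (2 * sin (lam / 2)) * x.
    rewrite -expi_shift subrr expi0 mulrBl mul1r; congr (expi _ * _ - _); by field.
  have -> : N = (size s)%:R * (lam / 2) - lam / 2 + lam / 2 by rewrite /N; ring.
  have -> : imag (2 * sin (lam / 2)) = (2 * sin (lam / 2))%:C%C * imag 1.
    by apply/eqP; rewrite eq_complex /=; apply/andP; split; apply/eqP; ring.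
  rewrite [in RHS]expiD [(_ * rho)%:C%C]rmorphM /=; ring.
have [sigma Hs] := choice coefE.
exists sigma => [x xs|w ws]; first by case: (Hs x xs).
have Pw0 : P.[w] != 0 by rewrite -rootE root_prod_XsubC.
(* The multiple of [P] removes the leading coefficient of the rotated polynomial. *)
pose Q := dilate (expi lam) P - expi (N + N) *: P.
have QE z : Q.[z] = P.[expi lam * z] - expi (N + N) * P.[z].
  by rewrite hornerD hornerN horner_dilate hornerZ.
have szP : size P = (size s).+1 by exact: size_prod_XsubC.
have szQ : (size Q <= size s)%N.
  apply/leq_sizeP => j; rewrite leq_eqVlt => /orP[/eqP <-|sj].
    rewrite coefB coefZ coef_dilate expiX.
    have -> : (size s)%:R * lam = N + N by rewrite /N; field.
    by rewrite mulrC subrr.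
  rewrite coefB coefZ coef_dilate.
  have -> : P`_j = 0 by apply: (leq_sizeP _ _ _ _ (leqnn j)); rewrite szP.
  by rewrite mul0r mulr0 subrr.
have e1 : expi (- N) * expi N = 1 :> R[i] by rewrite -expiD addNr expi0.
have -> : P.[expi lam * w] = Q.[w] + expi (N + N) * P.[w] by rewrite QE subrK.
rewrite (lagrange_interpolation w us szQ) mulrDl mulfK // mulrDr addrC.
congr (_ + _); first by rewrite -expiD; congr expi; ring.
rewrite mulr_suml mulr_sumr; apply: eq_big_seq => x xs.
have [_ Ex] := Hs x xs.
have Lx0 : (lagrange_node s x).[x] != 0 by rewrite lagrange_node_eq0 eqxx andbF.
have Lw0 : (lagrange_node s x).[w] != 0 by rewrite lagrange_node_eq0 (negPf ws).
have wx0 : w - x != 0 by rewrite subr_eq0; apply: contraNneq ws => ->.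
have -> : Q.[x] = P.[expi lam * x].
  by rewrite QE (PL x xs) [in X in _ - X]hornerM hornerXsubC subrr mul0r mulr0 subr0.
rewrite Ex (PL x xs) hornerM hornerXsubC.
transitivity (expi (- N) * expi N * ((sigma x)%:C%C * (imag 1 * x / (w - x)))).
  by field; rewrite wx0 Lw0.
by rewrite e1 mul1r.
Qed.

Lemma expi_neq1 (t : R) : 0 < `|t| < 2 * pi -> expi t != 1 :> R[i].
Proof. by move=> /cos_lt1 ct; apply/eqP => -[c1 _]; rewrite c1 ltxx in ct. Qed.

Lemma Im_sum (I : Type) (r : seq I) (P : pred I) (F : I -> R[i]) :
  complex.Im (\sum_(i <- r | P i) F i) = \sum_(i <- r | P i) complex.Im (F i).
Proof. by elim/big_rec2: _ => // i x y _ <-; rewrite ImD. Qed.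

(** Each partial fraction has imaginary part a positive multiple of
    [|w|^2 - 1] minus a constant.  On the unit circle only the constants and
    the term [expi (n lam / 2)] remain; their sum is zero since the quotient
    vanishes at a rotated zero. *)
Lemma rotation_quotient_Im s (lam : R) : {in s, forall y, nc y = 1} -> uniq s ->
  {in s &, forall x y, y != x -> 0 < lam < pi /\ complex.Re (x * y^*) < cos lam} ->
  0 < lam < 2 * pi -> (0 < size s)%N ->
  forall w, 1 < nc w ->
    0 < complex.Im (expi (- ((size s)%:R * lam / 2)) *
     ((\prod_(y <- s) ('X - y%:P)).[expi lam * w] / (\prod_(y <- s) ('X - y%:P)).[w])).
Proof.
move=> s1 us sep /andP[lam0 lam2] s0 w w1; set P := \prod_(y <- s) _.
have sl : 0 < sin (lam / 2) by apply: sin_gt0_pi; apply/andP; split; lra.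
have [sigma sg0 E] := rotation_quotient s1 us sep sl.
pose T := sin ((size s)%:R * lam / 2) - \sum_(x <- s) sigma x / 2.
have ImE v : v \notin s ->
    complex.Im (expi (- ((size s)%:R * lam / 2)) * (P.[expi lam * v] / P.[v])) =
    T + \sum_(x <- s) sigma x * ((nc v ^+ 2 - 1) / (2 * nc (v - x) ^+ 2)).
  move=> vs; rewrite E // ImD Im_sum /= /T -addrA; congr (_ + _).
  rewrite addrC -sumrB; apply: eq_big_seq => x xs.
  have vx : v != x by apply: contraNneq vs => ->.
  by rewrite Im_real (Re_half_plane (s1 x xs) vx); ring.
have [x1 x1s] : exists x, x \in s by case: (s) s0 => // x ? _; exists x; exact: mem_head.
have T0 : T = 0.
  (* Rotating [v] by [lam] gives the zero [x1], so the quotient vanishes there. *)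
  pose v := expi (- lam) * x1.
  have ev : expi lam * v = x1 by rewrite /v mulrA -expiD subrr expi0 mul1r.
  have nv : nc v = 1 by rewrite ncM nc_expi mul1r s1.
  have vs : v \notin s.
    apply/negP => vs; have [vx|vx] := eqVneq v x1.
      have : expi lam != 1 :> R[i] by apply: expi_neq1; rewrite gtr0_norm // lam0.
      move/eqP; apply; apply: (mulIf (x := x1)); last by rewrite mul1r -[in LHS]vx.
      by rewrite -nc_gt0 s1.
    have [_] := sep x1 v x1s vs vx; rewrite -{1}ev -mulrA mul_conj_nc nv expr1n mulr1.
    by rewrite ltxx.
  have := ImE v vs; rewrite nv expr1n subrr.
  under eq_bigr do rewrite mul0r mulr0.
  rewrite big1_eq addr0 ev => <-.
  have /eqP -> : P.[x1] == 0 by rewrite -rootE root_prod_XsubC.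
  by rewrite mul0r mulr0.
have ws : w \notin s by apply/negP => /s1 w1'; rewrite w1' ltxx in w1.
rewrite ImE // T0 add0r big_seq; case: (s) s0 x1s ws sg0 => // y s' _ _ ws sg0.
have term x : x \in y :: s' -> 0 < sigma x * ((nc w ^+ 2 - 1) / (2 * nc (w - x) ^+ 2)).
  move=> xs; rewrite mulr_gt0 ?sg0 // divr_gt0 ?subr_gt0 ?exprn_egt1 //.
  rewrite mulr_gt0 // exprn_gt0 // nc_gt0 subr_eq0.
  by apply: contraNneq ws => ->.
rewrite -big_seq big_cons ltr_wpDr ?term ?mem_head //.
by rewrite big_seq sumr_ge0 // => x xs; rewrite ltW // term // in_cons xs orbT.
Qed.

Theorem class_T_Im n (lam : R) F : (0 < n)%N -> 0 < lam < 2 * pi / n%:R ->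
  class_T n lam F -> forall z, 1 < nc z ->
  0 < complex.Im (expi (- (n%:R * lam / 2)) *
        (F.[expi (lam / 2) * z] / F.[expi (- (lam / 2)) * z])).
Proof.
move=> n0 /andP[lam0 lamn] [szF [s [FE s1 sepF]]] z z1.
have lam2 : lam < 2 * pi.
  have n1 : 1 <= n%:R :> R by rewrite ler1n.
  rewrite ltr_pdivlMr ?ltr0n // in lamn; nra.
have {}s1 : {in s, forall y, nc y = 1} by move=> y /s1 /normc_eq1.
have c0 : lead_coef F != 0 by rewrite lead_coef_eq0 -size_poly_eq0 szF.
have szs : size s = n by apply/eq_add_S; rewrite -szF FE size_scale // size_prod_XsubC.
pose e : rel R[i] := fun x y => (0 < lam < pi) && (complex.Re (x * y^*) < cos lam).
have lam_e x y : nc x = 1 -> nc y = 1 -> lam < angle x y -> e x y.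
  move=> nx ny; rewrite /angle /e; set a := complex.Re _ => lt_a.
  have a1 : -1 <= a <= 1.
    by rewrite -ler_norml (le_trans (normRe_le _)) // ncM nc_conj nx ny mulr1.
  have ap := acos_lepi a1.
  rewrite lam0 (lt_le_trans lt_a ap) /=.
  rewrite -[ltLHS]acosK ?in_itv //= ltr_cos // in_itv /= ?acos_ge0 ?ap //.
  by rewrite ltW //= ltW // (lt_le_trans lt_a ap).
have pe : pairwise e s.
  apply: (sub_in_pairwise (P := mem s)) sepF; last exact/allP.
  by move=> x y xs ys; apply: lam_e; exact: s1.
have e_sym : symmetric e.
  move=> x y; rewrite /e; congr (_ && (_ < _)).
  by case: x => a b; case: y => c d /=; ring.
have e_irr x : x \in s -> ~~ e x x.
  move=> xs; rewrite /e mul_conj_nc s1 // expr1n /=.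
  by rewrite [1 < _]ltNge cos_le1 andbF.
have us : uniq s.
  rewrite uniq_pairwise; apply: (sub_in_pairwise (P := mem s)) pe; last exact/allP.
  by move=> x y xs ys /= exy; apply: contraTneq exy => <-; exact: e_irr.
pose e' : rel R[i] := fun x y => (x == y) || e x y.
have : all2rel e' s.
  rewrite -pairwise_all2rel.
  - by apply: sub_pairwise pe => x y exy; rewrite /e' exy orbT.
  - by move=> x; rewrite /e' eqxx.
  - by move=> x y; rewrite /e' eq_sym e_sym.
move=> /allrelP e's.
have sep : {in s &, forall x y, y != x -> 0 < lam < pi /\ complex.Re (x * y^*) < cos lam}.
  move=> x y xs ys yx; apply/andP.
  by have := e's x y xs ys; rewrite /e' eq_sym (negPf yx).
have s0 : (0 < size s)%N by rewrite szs.
have lam02 : 0 < lam < 2 * pi by rewrite lam0.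
pose w := expi (- (lam / 2)) * z.
have w1 : 1 < nc w by rewrite ncM nc_expi mul1r.
have := rotation_quotient_Im s1 us sep lam02 s0 w1; rewrite szs.
have -> : expi lam * w = expi (lam / 2) * z.
  by rewrite /w mulrA -expiD; congr (expi _ * _); field.
rewrite FE !hornerZ -mulf_div divff // mul1r; exact.
Qed.

End SeparatedZeros.

(** * The coefficients of the Suffridge polynomial and the inverse of a polynomial *)

Section Suffridge.
Variable R : realType.
Local Notation nc := (@Normc.normc R).
Implicit Types (lam : R) (z : R[i]) (n j : nat).

Lemma dilate_comp (s : R[i]) (P : {poly R[i]}) : dilate s P = P \Po (s *: 'X).
Proof.
rewrite comp_polyE /dilate poly_def; apply: eq_bigr => j _.
by rewrite exprZn scalerA.
Qed.

(** Rotation by [lam] shifts the factors by one, so the two sides differ only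
    in how the first and last factor are named. *)
Lemma suffridge_functional n lam :
  dilate (expi lam) (suffridge_poly n lam) * (1 + expi ((1 - n%:R) * lam / 2) *: 'X) =
  suffridge_poly n lam * (1 + expi ((n%:R + 1) * lam / 2) *: 'X).
Proof.
pose factor j : {poly R[i]} := 1 + expi (((2 * j)%N%:R - n%:R - 1) * lam / 2) *: 'X.
have -> : 1 + expi ((1 - n%:R) * lam / 2) *: 'X = factor 1%N.
  by rewrite /factor; congr (1 + expi (_ * _ / _) *: _); ring.
have -> : 1 + expi ((n%:R + 1) * lam / 2) *: 'X = factor n.+1.
  by rewrite /factor; congr (1 + expi (_ * _ / _) *: _); rewrite natrM -natr1; ring.
have -> : dilate (expi lam) (suffridge_poly n lam) = \prod_(1 <= j < n.+1) factor j.+1.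
  rewrite dilate_comp rmorph_prod; apply: eq_bigr => j _.
  rewrite /= comp_polyD comp_polyZ comp_polyX -polyC1 comp_polyC.
  rewrite scalerA -expiD polyC1 /factor; congr (1 + expi _ *: _).
  by rewrite !natrM -natr1; field.
have -> : suffridge_poly n lam = \prod_(1 <= j < n.+1) factor j by [].
by rewrite mulrC -big_nat_recl //= big_nat_recr.
Qed.

Lemma Ccoef0 n lam : Ccoef n lam 0 = 1.
Proof.
rewrite /Ccoef -horner_coef0 /suffridge_poly horner_prod big1 // => j _.
by rewrite hornerD hornerZ hornerX mulr0 hornerC addr0.
Qed.

Lemma Ccoef_rec n lam j : Ccoef n lam j.+1 * (sin (j.+1%:R * lam / 2))%:C%C =
  Ccoef n lam j * (sin ((n%:R - j%:R) * lam / 2))%:C%C.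
Proof.
have := congr1 (fun P : {poly R[i]} => P`_j.+1) (suffridge_functional n lam).
rewrite /= !mulrDr !mulr1 !coefD -!scalerAr !coefZ !coefMX /= !coef_dilate.
rewrite -!/(Ccoef n lam _) !expiX => E.
pose x : R := j.+1%:R * lam / 2; pose y : R := (n%:R - j%:R) * lam / 2.
have E2 : Ccoef n lam j.+1 * (expi (x + x) - expi (x - x)) =
          Ccoef n lam j * (expi (x + y) - expi (x - y)).
  have -> : x + x = j.+1%:R * lam by rewrite /x; field.
  have -> : x + y = (n%:R + 1) * lam / 2 by rewrite /x /y -natr1; field.
  have -> : expi (x - y) = expi ((1 - n%:R) * lam / 2) * expi (j%:R * lam) :> R[i].
    by rewrite -expiD; congr expi; rewrite /x /y -natr1; field.
  rewrite subrr expi0 !mulrBr mulr1.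
  apply/eqP; rewrite -subr_eq0; move/eqP: E; rewrite -subr_eq0 => /eqP <-.
  by apply/eqP; ring.
have imE t : imag (2 * t) = imag 2 * t%:C%C :> R[i].
  by apply/eqP; rewrite eq_complex /=; apply/andP; split; apply/eqP; ring.
rewrite !expi_shift !imE in E2.
have i0 : expi x * imag 2 != 0 :> R[i].
  by rewrite mulf_neq0 ?expi_neq0 // eq_complex /= negb_and pnatr_eq0 orbT.
apply: (mulfI i0); move: E2; rewrite -/x -/y => E2.
transitivity (Ccoef n lam j.+1 * (expi x * (imag 2 * (sin x)%:C%C))); first by ring.
by rewrite E2; ring.
Qed.

Lemma sin_gt0_mul n lam (t : R) : (0 < n)%N -> 0 < lam < 2 * pi / n%:R -> 0 < t <= n%:R ->
  0 < sin (t * lam / 2).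
Proof.
move=> n0 /andP[lam0 lamn] /andP[t0 tn].
rewrite ltr_pdivlMr ?ltr0n // in lamn.
by apply: sin_gt0_pi; apply/andP; split; nra.
Qed.

Lemma Ccoef_gt0 n lam j : (0 < n)%N -> 0 < lam < 2 * pi / n%:R -> (j <= n)%N ->
  exists2 c : R, 0 < c & Ccoef n lam j = c%:C%C.
Proof.
move=> n0 lamn; elim: j => [|j IH] jn; first by exists 1; rewrite ?Ccoef0.
have [c c0 E] := IH (ltnW jn).
have s1 : 0 < sin (j.+1%:R * lam / 2).
  by apply: sin_gt0_mul n0 lamn _; rewrite ltr0n ler_nat.
have s2 : 0 < sin ((n%:R - j%:R) * lam / 2).
  by apply: sin_gt0_mul n0 lamn _; rewrite subr_gt0 ltr_nat jn lerBlDr lerDl /=.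
exists (c * sin ((n%:R - j%:R) * lam / 2) / sin (j.+1%:R * lam / 2)).
  by rewrite divr_gt0 ?mulr_gt0.
have s1' : (sin (j.+1%:R * lam / 2))%:C%C != 0 :> R[i].
  by rewrite eq_complex /= negb_and gt_eqF.
apply: (mulIf s1'); rewrite Ccoef_rec E -!rmorphM; congr (_%:C%C).
by rewrite divfK // gt_eqF.
Qed.

Lemma coef_ninverse n (p : {poly R[i]}) j : (j <= n)%N ->
  (ninverse n p)`_j = (p`_(n - j)%N)^*.
Proof. by move=> jn; rewrite coef_poly ltnS jn. Qed.

Lemma horner_ninverse n (F : {poly R[i]}) z : (size F <= n.+1)%N -> z != 0 ->
  (ninverse n F).[z] = z ^+ n * (F.[(z^*)^-1])^*.
Proof.
move=> szF z0; rewrite horner_poly (horner_coef_wide _ szF) rmorph_sum mulr_sumr /=.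
rewrite (reindex_inj rev_ord_inj) /=; apply: eq_bigr => j _.
have jn : (j <= n)%N by rewrite -ltnS.
rewrite subSS subKn // rmorphM rmorphXn /= fmorphV /= conjCK.
rewrite mulrCA; congr (_ * _).
have -> : z ^+ n = z ^+ (n - j) * z ^+ j by rewrite -exprD subnK.
by rewrite exprVn mulfK ?expf_neq0.
Qed.

(** The difference of the squared moduli is [- 4 sin alpha] times the
    imaginary part. *)
Lemma nc_sub_lt (q1 q2 : R[i]) (alpha : R) : 0 < sin alpha ->
  complex.Im (expi (- alpha) * (q1 * q2^*)) < 0 ->
  nc (q1 - q2) < nc (expi alpha * q2 - expi (- alpha) * q1).
Proof.
move=> sa; rewrite -subr_gt0 => Im_lt0.
rewrite -(@ltr_pXn2r _ 2) ?nnegrE ?nc_ge0 // !sqr_nc -subr_gt0.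
have cs := cos2Dsin2 alpha.
move: Im_lt0; case: q1 => a b; case: q2 => c d /=; rewrite cosN sinN.
move: (cos alpha) (sin alpha) sa cs => co s s0 cs Im_lt0.
have -> : ((co * c - s * d - (co * a - - s * b)) ^+ 2 +
   (co * d + s * c - (co * b + - s * a)) ^+ 2 -
   ((a - c) ^+ 2 + (b - d) ^+ 2)) =
  4 * s * (0 - (co * (a * - d + b * c) + - s * (a * c - b * - d))) +
  (co ^+ 2 + s ^+ 2 - 1) * (a ^+ 2 + b ^+ 2 + c ^+ 2 + d ^+ 2 - 2 * (a * c + b * d)).
  by ring.
by rewrite cs subrr mul0r addr0 !mulr_gt0.
Qed.

End Suffridge.

(** * From the class of polynomials to a block recursion *)

Section PD.
Variable R : realType.
Local Notation nc := (@Normc.normc R).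
Implicit Types (lam : R) (z : R[i]) (n j m : nat).

Lemma class_D_Im n lam (F : {poly R[i]}) : (0 < n)%N -> 0 < lam < 2 * pi / n%:R ->
  class_D n lam F -> forall z, 1 < nc z ->
  0 < complex.Im (expi (- (n%:R * lam / 2)) *
        (F.[expi (lam / 2) * z] / F.[expi (- (lam / 2)) * z])).
Proof.
move=> n0 lamn [|[_ H] z z1]; first exact: class_T_Im.
by apply: H; rewrite normE -(rmorph1 (real_complex R)) lecR ltW.
Qed.

Lemma expiV (t : R) : (expi t)^-1 = expi (- t) :> R[i].
Proof.
by apply: (mulfI (expi_neq0 t)); rewrite mulfV ?expi_neq0 // -expiD subrr expi0.
Qed.

Lemma ninverse_Im n lam (F : {poly R[i]}) : (size F <= n.+1)%N ->
  (forall z, 1 < nc z ->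
    0 < complex.Im (expi (- (n%:R * lam / 2)) *
        (F.[expi (lam / 2) * z] / F.[expi (- (lam / 2)) * z]))) ->
  forall z, z != 0 -> nc z < 1 ->
    complex.Im (expi (- (n%:R * lam / 2)) *
      ((ninverse n F).[expi (lam / 2) * z] *
       ((ninverse n F).[expi (- (lam / 2)) * z])^*)) < 0.
Proof.
move=> szF H z z0 z1; set al := n%:R * lam / 2.
(* The reflection of [z] in the unit circle lies outside the disk. *)
pose u := (z^*)^-1.
have u1 : 1 < nc u by rewrite /u ncV nc_conj invf_gt1 // nc_gt0.
have := H u u1; rewrite -/al.
have rot (t : R) : ((expi t * z)^*)^-1 = expi t * u.
  by rewrite rmorphM /= invfM /u -expiN expiV opprK.
have hn (t : R) : (ninverse n F).[expi t * z] =
    expi (n%:R * t) * z ^+ n * (F.[expi t * u])^*.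
  by rewrite horner_ninverse ?mulf_neq0 ?expi_neq0 // rot exprMn expiX.
rewrite !hn -/al; set f1 := F.[expi (lam / 2) * u]; set f2 := F.[_ * u].
have [->|f20] := eqVneq f2 0; first by rewrite invr0 !mulr0 /= ltxx.
have -> : n%:R * (lam / 2) = al by rewrite /al; ring.
have -> : n%:R * (- (lam / 2)) = - al by rewrite /al; ring.
pose k : R := nc (z ^+ n) ^+ 2 * nc f2 ^+ 2.
have k0 : 0 < k by rewrite mulr_gt0 // exprn_gt0 // nc_gt0 ?expf_neq0.
have -> : expi (- al) * (expi al * z ^+ n * f1^* * (expi (- al) * z ^+ n * f2^*)^*) =
    k%:C%C * (expi (- al) * (f1 / f2))^*.
  have -> : (expi (- al) * z ^+ n * f2^*)^* = expi al * (z ^+ n)^* * f2.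
    by rewrite !rmorphM /= conjCK expiN conjCK.
  have -> : (expi (- al) * (f1 / f2))^* = expi al * (f1^* / f2^*).
    by rewrite !rmorphM /= fmorphV /= expiN conjCK.
  have f2c : f2^* != 0 by rewrite conjC_eq0.
  rewrite [k%:C%C]rmorphM /= -!mul_conj_nc.
  have e1 : expi (- al) * expi al = 1 :> R[i] by rewrite -expiD addNr expi0.
  transitivity (expi (- al) * expi al * (expi al * (z ^+ n * (z ^+ n)^*) * f1^* * f2)).
    by ring.
  rewrite e1 mul1r; move: f2c; move: (f2^*) (f1^*) ((z ^+ n)^*) => a b c a0; field.
  exact: a0.
move=> Im_gt0; rewrite Im_real.
have -> : forall x : R[i], complex.Im (x^*) = - complex.Im x by case.
by rewrite mulrN oppr_lt0 mulr_gt0.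
Qed.

Lemma exists_quotient (B D : {poly R[i]}) : D`_0 != 0 -> exists nu, is_quotient nu B D.
Proof.
move=> D0.
have [|nu nuE] := @strong_recursion R
  (fun j u => (B`_j - \sum_(i < j) u i * D`_(j - i)) / D`_0).
  by move=> j u v uv; congr ((_ - _) / _); apply: eq_bigr => i _; rewrite uv.
by exists nu => j; rewrite big_ord_recr /= subnn nuE divfK // addrC subrK.
Qed.

(** [A] and [B] are the two combinations of [Q(expi (lam/2) z)] and
    [Q(expi (-lam/2) z)] whose coefficients carry the sines of [j lam / 2] and
    [(n - j) lam / 2].  The recursion of [Ccoef] identifies the weight of [A]
    at [j] with that of [B] at [j.-1], and the weights of [B - A] with
    [E m * (1 - r m)]. *)
Theorem class_PD_blocks n lam (p : {poly R[i]}) (b := fun j => (ninverse n p)`_j) :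
  (0 < n)%N -> 0 < lam < 2 * pi / n%:R -> class_PD n lam p -> b 0%N = 1 ->
  exists nu, [/\ nu 0%N = 1, contractive nu &
    forall j, (0 < j <= n)%N -> b j = blocks (sine_ratio n lam) nu b j].
Proof.
move=> n0 lamn [szp Dp] b0.
pose F := \poly_(j < n.+1) (Ccoef n lam j * p`_j).
pose gam j := Ccoef n lam (n - j).
pose s j : R := sin (j%:R * lam / 2).
pose S j : R := sin ((n%:R - j%:R) * lam / 2).
pose E j : R[i] := gam j * (S j)%:C%C.
have S_gt0 j : (j < n)%N -> 0 < S j.
  move=> jn; apply: sin_gt0_mul n0 lamn _.
  by rewrite subr_gt0 ltr_nat jn lerBlDr lerDl /=.
have C0 x : x != 0 -> x%:C%C != 0 :> R[i].
  by move=> x0; rewrite eq_complex /= negb_and x0.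
have gam0 j : gam j != 0.
  have [c c0 E1] := Ccoef_gt0 n0 lamn (leq_subr j n).
  by rewrite /gam E1 C0 // gt_eqF.
have E0 j : (j < n)%N -> E j != 0.
  by move=> jn; rewrite mulf_neq0 // C0 // gt_eqF // S_gt0.
have Estep j : (0 < j <= n)%N -> E j.-1 = gam j * (s j)%:C%C.
  case: j => // j /= jn; rewrite /E /gam /s /S.
  have := Ccoef_rec n lam (n - j.+1); rewrite -subSn // subSS => E1.
  have nE : n%:R - j%:R = (n - j)%N%:R :> R by rewrite natrB // ltnW.
  rewrite nE E1; congr (_ * (sin (_ * _ / _))%:C%C); rewrite natrB //; ring.
pose G := ninverse n F.
have Gj j : (j <= n)%N -> G`_j = gam j * b j.
  move=> jn; rewrite coef_ninverse // coef_poly ltnS leq_subr rmorphM /b coef_ninverse //.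
  have [c c0 E1] := Ccoef_gt0 n0 lamn (leq_subr j n).
  by rewrite /gam E1; congr (_ * _); apply/eqP; rewrite eq_complex /= oppr0 !eqxx.
have szG : (size G <= n.+1)%N by exact: size_poly.
have szF : (size F <= n.+1)%N by exact: size_poly.
pose A : {poly R[i]} := \poly_(j < n.+1) (gam j * (s j)%:C%C * b j).
pose B : {poly R[i]} := \poly_(j < n.+1) (E j * b j).
pose al := n%:R * lam / 2.
have imE t : imag (2 * t) = imag 2 * t%:C%C :> R[i].
  by apply/eqP; rewrite eq_complex /=; apply/andP; split; apply/eqP; ring.
have sinE t : imag 2 * (sin t)%:C%C = expi t - expi (- t) :> R[i].
  by have := expi_shift 0 t; rewrite expi0 mul1r imE add0r sub0r.
have AE z : imag 2 * A.[z] = G.[expi (lam / 2) * z] - G.[expi (- (lam / 2)) * z].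
  rewrite horner_poly !(horner_coef_wide _ szG) -sumrB mulr_sumr.
  apply: eq_bigr => j _; rewrite Gj -1?ltnS // !exprMn !expiX.
  transitivity (gam j * b j * z ^+ j * (imag 2 * (s j)%:C%C)); first by ring.
  rewrite /s sinE; have -> : j%:R * lam / 2 = j%:R * (lam / 2) by ring.
  by rewrite mulrN; ring.
have BE z : imag 2 * B.[z] =
    expi al * G.[expi (- (lam / 2)) * z] - expi (- al) * G.[expi (lam / 2) * z].
  rewrite horner_poly !(horner_coef_wide _ szG) !mulr_sumr -sumrB.
  apply: eq_bigr => j _; rewrite Gj -1?ltnS // !exprMn !expiX /E.
  transitivity (gam j * b j * z ^+ j * (imag 2 * (S j)%:C%C)); first by ring.
  rewrite /S sinE.
  have -> : (n%:R - j%:R) * lam / 2 = al + j%:R * (- (lam / 2)) by rewrite /al; ring.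
  have -> : - (al + j%:R * - (lam / 2)) = - al + j%:R * (lam / 2) by ring.
  by rewrite !expiD; ring.
have sal : 0 < sin al by apply: (sin_gt0_mul n0 lamn); rewrite ltr0n n0 lexx.
have im0 : 0 < nc (imag 2 : R[i]).
  by rewrite nc_gt0 eq_complex /= negb_and pnatr_eq0 orbT.
have A0 : A`_0 = 0 by rewrite coef_poly /= /s !mul0r sin0 mulr0 mul0r.
have B0 : B`_0 = E 0%N by rewrite coef_poly /= b0 mulr1.
have AB z : nc z < 1 -> nc A.[z] < nc B.[z].
  move=> z1; have [->|z0] := eqVneq z 0.
    by rewrite !horner_coef0 A0 B0 nc0 nc_gt0 E0.
  rewrite -(ltr_pM2l im0) -!ncM AE BE; apply: nc_sub_lt sal _.
  exact: ninverse_Im szF (class_D_Im n0 lamn Dp) z z0 z1.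
pose D := B - A.
have D0 : D`_0 = E 0%N by rewrite coefB A0 B0 subr0.
have [nu quot] : exists nu, is_quotient nu B D by apply: exists_quotient; rewrite D0 E0.
have nu0 : nu 0%N = 1.
  have := quot 0%N; rewrite big_ord1 /= subnn D0 B0.
  by rewrite -[X in _ = X]mul1r => /(mulIf (E0 0%N n0)).
exists nu; split => //.
  apply: (Caratheodory nu0 quot) => z z1.
  have BD : B.[z] - D.[z] = A.[z] by rewrite hornerD hornerN; ring.
  rewrite BD ltW ?AB //; split => //; apply/eqP => Dz0.
  by have := AB z z1; rewrite -BD Dz0 subr0 ltxx.
move=> j /andP[j0 jn].
have j1n : (j.-1 < n)%N by rewrite prednK.
apply: (mulfI (E0 _ j1n)).
have Dm m : (m < n)%N -> D`_m = E m * (1 - sine_ratio n lam m)%:C%C * b m.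
  move=> mn; rewrite coefB !coef_poly ltnS (ltnW mn) /E.
  have -> : s m = S m * sine_ratio n lam m.
    by rewrite /sine_ratio -/(s m) -/(S m) mulrC divfK // gt_eqF // S_gt0.
  by rewrite rmorphB rmorph1 [(_ * _)%:C%C]rmorphM /=; ring.
(* Iterate [E l.-1 = r l * E l]. *)
have Em m i : (m + i < n)%N ->
    E m = E (m + i)%N * (\prod_(m.+1 <= l < (m + i).+1) sine_ratio n lam l)%:C%C.
  elim: i => [|i IH] mi; first by rewrite addn0 big_geq // mulr1.
  rewrite IH; last by lia.
  rewrite addnS [in RHS]big_nat_recr /=; last by lia.
  have -> : E (m + i)%N = E (m + i).+1 * (sine_ratio n lam (m + i).+1)%:C%C.
    have /Estep /= -> : (0 < (m + i).+1 <= n)%N by apply/andP; split=> //; rewrite -addnS ltnW.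
    rewrite /E -mulrA -rmorphM; congr (_ * _%:C%C).
    by rewrite /sine_ratio -/(s _) -/(S _) mulrC divfK // gt_eqF // S_gt0 //; lia.
  by rewrite [(_ * sine_ratio _ _ _)%:C%C]rmorphM /=; ring.
have := quot j; rewrite big_ord_recl /= subn0 nu0 mul1r.
have -> : B`_j = D`_j + A`_j by rewrite coefB subrK.
move=> /addrI; rewrite {1}/A coef_poly ltnS jn -Estep ?j0 // => <-.
rewrite /blocks mulr_sumr.
under eq_bigr do rewrite /bump /= add1n.
rewrite (reindex_inj rev_ord_inj) /=; apply: eq_bigr => m _.
have mj := ltn_ord m.
rewrite subnSK // subKn; last exact: ltnW.
rewrite Dm; last exact: leq_trans mj jn.
have := Em m (j.-1 - m)%N; rewrite subnKC; last by lia.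
rewrite prednK // => /(_ jn) ->.
rewrite /block_weight [in RHS]rmorphM /=; ring.
Qed.

End PD.

(** * Passage to the limit *)

Section Limit.
Variable R : realType.
Local Notation nc := (@Normc.normc R).
Implicit Types (lam : R) (z : R[i]) (n j m : nat).

Lemma geometric_tail (q : R) J N : 0 <= q < 1 -> (J <= N)%N ->
  \sum_(J <= j < N) q ^+ j <= q ^+ J / (1 - q).
Proof.
move=> /andP[q0 q1] JN; rewrite ler_pdivlMr ?subr_gt0 // mulr_suml.
have -> : \sum_(J <= j < N) q ^+ j * (1 - q) = q ^+ J - q ^+ N.
  rewrite -[RHS]opprB -(telescope_sumr (fun j => q ^+ j)) // -sumrN.
  by apply: eq_bigr => j _; rewrite exprS; ring.
by rewrite gerBl exprn_ge0.
Qed.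

(** The image of the disk of radius [r] under [w -> 1 / (1 - w)] is the disk
    with the real diameter from [1 / (1 + r)] to [1 / (1 - r)]. *)
Lemma Cayley_disk (w : R[i]) (r : R) : 0 <= r < 1 -> nc w <= r ->
  nc ((1 - w)^-1 - ((1 - r ^+ 2)^-1)%:C%C) <= r / (1 - r ^+ 2).
Proof.
move=> /andP[r0 r1] wr; have r2 : 0 < 1 - r ^+ 2 by nra.
have w1 : 1 - w != 0.
  by rewrite subr_eq0; apply: contraTneq wr => <-; rewrite nc1 -ltNge.
have r2C : (1 - r ^+ 2)%:C%C != 0 :> R[i] by rewrite eq_complex /= negb_and gt_eqF.
have -> : (1 - w)^-1 - ((1 - r ^+ 2)^-1)%:C%C =
    (w - (r ^+ 2)%:C%C) / (1 - w) * ((1 - r ^+ 2)^-1)%:C%C.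
  rewrite fmorphV /= rmorphB rmorph1 /= in r2C *; move: r2C.
  by move: (real_complex R (r ^+ 2)) => x x1; field; rewrite x1 w1.
have ir : 0 < (1 - r ^+ 2)^-1 by rewrite invr_gt0.
rewrite ncM nc_real (gtr0_norm ir) ler_pM2r // ncM ncV.
rewrite ler_pdivrMr ?nc_gt0 // -(@ler_pXn2r _ 2) ?nnegrE ?mulr_ge0 ?nc_ge0 //.
have : nc w ^+ 2 <= r ^+ 2 by rewrite lerXn2r ?nnegrE ?nc_ge0.
rewrite exprMn !sqr_nc; case: (w) => a b /= h.
have : 0 <= (1 - r ^+ 2) * (r ^+ 2 - (a ^+ 2 + b ^+ 2)).
  by apply: mulr_ge0; [exact: ltW | rewrite subr_ge0].
nra.
Qed.

Lemma Re_gt_half (x : R[i]) (r : R) : 0 <= r < 1 ->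
  nc (x - ((1 - r ^+ 2)^-1)%:C%C) <= r / (1 - r ^+ 2) -> 2^-1 < complex.Re x.
Proof.
move=> /andP[r0 r1]; have r2 : 0 < 1 - r ^+ 2 by nra.
move=> /(le_trans (normRe_le _)); rewrite ReD ReN /= ler_norml => /andP[+ _].
have -> : - (r / (1 - r ^+ 2)) = (1 + r)^-1 - (1 - r ^+ 2)^-1.
  have -> : 1 - r ^+ 2 = (1 - r) * (1 + r) by ring.
  by field; apply/andP; split; apply: lt0r_neq0; lra.
have : 2^-1 < (1 + r)^-1 by rewrite ltf_pV2 ?posrE; lra.
lra.
Qed.

(** The functional is applied to the truncated geometric series of
    [1 / (1 - z y)] in [y], recentred so that its modulus is small. *)
Lemma contractive_partial_sum (b : nat -> R[i]) z J (r := nc z) :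
  contractive b -> b 0%N = 1 -> r < 1 ->
  nc (\sum_(j < J) b j * z ^+ j - ((1 - r ^+ 2)^-1)%:C%C) <=
  r / (1 - r ^+ 2) + r ^+ J / (1 - r).
Proof.
move=> cb b0 r1; have r0 : 0 <= r by exact: nc_ge0.
set c := ((1 - r ^+ 2)^-1)%:C%C.
pose P : {poly R[i]} := \sum_(j < J) z ^+ j *: 'X^j - c%:P.
have <- : mean b P = \sum_(j < J) b j * z ^+ j - c.
  rewrite /P linearB /= meanC // linear_sum; congr (_ - _).
  by apply: eq_bigr => j _; rewrite linearZ /= meanXn mulrC.
apply: cb => y y1.
have zy : nc (z * y) <= r by rewrite ncM ler_piMr.
have zy1 : 1 - z * y != 0.
  by rewrite subr_eq0; apply: contraTneq zy => <-; rewrite nc1 -ltNge.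
have -> : P.[y] = ((1 - z * y)^-1 - c) - (z * y) ^+ J / (1 - z * y).
  rewrite /P hornerD hornerN hornerC horner_sum.
  have -> : \sum_(j < J) (z ^+ j *: 'X^j).[y] = (1 - (z * y) ^+ J) / (1 - z * y).
    have -> : 1 - (z * y) ^+ J = (\sum_(j < J) (z * y) ^+ j) * (1 - z * y).
      by rewrite -[LHS]opprB subrX1; ring.
    by rewrite mulfK //; apply: eq_bigr => j _; rewrite hornerZ hornerXn exprMn.
  by ring.
apply: le_trans (ncD _ _) _; rewrite ncN lerD //.
  by apply: Cayley_disk => //; rewrite r0.
rewrite ncM ncV ncX ler_pM ?exprn_ge0 ?invr_ge0 ?nc_ge0 //.
  by rewrite lerXn2r ?nnegrE ?nc_ge0.
rewrite lef_pV2 ?posrE ?subr_gt0 ?nc_gt0 //.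
have := ncD (1 - z * y) (z * y); rewrite subrK nc1; lra.
Qed.

(** The sequence [c] solves the recursion with urn ratios for the same
    [nu] as the coefficients of the inverse. *)
Lemma class_PD_contractive n lam (p : {poly R[i]}) J (b := fun j => (ninverse n p)`_j) :
  (0 < n)%N -> 0 < lam < 2 * pi / n%:R -> class_PD n lam p -> b 0%N = 1 ->
  (2 * J <= n)%N ->
  exists c, [/\ c 0%N = 1, contractive c &
    forall j, (j <= J)%N -> nc (b j - c j) <= j%:R ^+ 3 * (16 * J%:R / n%:R)].
Proof.
move=> n0 lamn PDp b0 Jn.
have [nu [nu0 cnu bE]] := class_PD_blocks n0 lamn PDp b0.
pose delta := 2 * pi / lam - n%:R.
have delta0 : 0 < delta.
  case/andP: lamn => lam0; rewrite ltr_pdivlMr ?ltr0n // => lamn.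
  by rewrite subr_gt0 ltr_pdivlMr // mulrC.
have [c c0 cE] := exists_block_solution (urn_ratio delta) nu.
exists c; split => //; first exact: block_solution_contractive delta0 nu0 cnu c0 cE.
apply: (block_solutions_close (r := sine_ratio n lam) (s := urn_ratio delta) (nu := nu)) => //.
- exact: sine_ratio0.
- exact: urn_ratio0.
- by move=> l lJ; apply: sine_ratio01 => //; lia.
- by move=> l lJ; apply: urn_ratio01.
- move=> l lJ; apply: le_trans (sine_ratio_urn n0 lamn _) _; first by lia.
  by rewrite ler_pM2r ?invr_gt0 ?ltr0n // ler_pM2l // ler_nat ltnW.
- by move=> i; apply: contractive_le1.
- by move=> j /andP[j0 jJ]; apply: bE; rewrite j0 /=; lia.
- by move=> j /andP[j0 _]; apply: cE.
Qed.

Lemma continuous_circle (rho : R) :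
  continuous (fun t : R => (rho%:C%C * expi t : R[i]^o)).
Proof.
move=> t; apply/cvgrPdist_lt => e; rewrite ltcE /= => /andP[/eqP Ime Ree].
have -> : e = (complex.Re e)%:C%C by case: e Ime {Ree} => a b /= ->.
pose d := complex.Re e / (2 * (`|rho| + 1)).
have rho1 : 0 < `|rho| + 1 by rewrite ltr_wpDl.
have d0 : 0 < d by rewrite divr_gt0 // mulr_gt0.
near=> s; rewrite normE ltcR -mulrBr ncM nc_real.
have cs : `|cos t - cos s| < d.
  by near: s; move: (@continuous_cos R t) => /cvgrPdist_lt; apply.
have sn : `|sin t - sin s| < d.
  by near: s; move: (@continuous_sin R t) => /cvgrPdist_lt; apply.
have : nc (expi t - expi s) <= `|cos t - cos s| + `|sin t - sin s|.
  have -> : expi t - expi s = (cos t - cos s)%:C%C + imag 1 * (sin t - sin s)%:C%C.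
    apply/eqP; rewrite eq_complex /=; apply/andP; split; apply/eqP; ring.
  apply: le_trans (ncD _ _) _; rewrite ncM !nc_real.
  by rewrite /imag /= expr0n expr1n add0r sqrtr1 mul1r.
have -> : complex.Re e = 2 * d * (`|rho| + 1) by rewrite /d; field; rewrite gt_eqF.
have := normr_ge0 rho; have := nc_ge0 (expi t - expi s).
move: (nc _) => x x0 rho0 xle.
apply: (@le_lt_trans _ _ (`|rho| * (2 * d))); first by rewrite ler_wpM2l //; lra.
nra.
Unshelve. all: by end_near.
Qed.

Lemma compact_circle (rho : R) :
  compact ((fun t : R => (rho%:C%C * expi t : R[i]^o)) @` `[0, 2 * pi]).
Proof.
apply: continuous_compact; last exact: segment_compact.
exact/continuous_subspaceT/continuous_circle.
Qed.

Lemma uniform_cvg_nc (K : set R[i]^o) (q : nat -> R[i]^o -> R[i]^o) (f : R[i]^o -> R[i]^o) :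
  {uniform K, q @ \oo --> f} -> forall e : R, 0 < e ->
  exists N, forall k, (N <= k)%N -> forall w, K w -> nc (f w - q k w) <= e.
Proof.
move=> qf e e0.
have eC : 0 < e%:C%C :> R[i] by rewrite ltcE /= eqxx.
have := qf [set h | forall w, K w -> `|f w - h w| < e%:C%C].
case.
  apply/uniform_nbhs; exists [set xy : R[i]^o * R[i]^o | ball xy.1 e%:C%C xy.2].
  by split; [exact: (entourage_ball _ (PosNum eC)) | move=> h Hh w Kw; exact: Hh].
move=> N _ HN; exists N => k Nk w Kw.
have := HN k Nk w Kw; rewrite normE ltcR; exact: ltW.
Qed.

End Limit.

Section Final.
Variable R : realType.
Local Notation nc := (@Normc.normc R).

(** Cauchy estimates at radius [rho] make the tail geometric. *)
Lemma horner_tail (q : {poly R[i]}) z (rho Bd : R) J : 0 < rho ->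
  (forall j, nc q`_j * rho ^+ j <= Bd) -> nc z < rho ->
  nc (q.[z] - \sum_(j < J) q`_j * z ^+ j) <= Bd * ((nc z / rho) ^+ J / (1 - nc z / rho)).
Proof.
move=> rho0 qB zr; set N := maxn J (size q).
have JN : (J <= N)%N by exact: leq_maxl.
have Bd0 : 0 <= Bd.
  by apply: le_trans (qB 0%N); rewrite expr0 mulr1 nc_ge0.
rewrite (@horner_coef_wide _ N) ?leq_maxr //.
rewrite -(big_mkord xpredT (fun j => q`_j * z ^+ j)).
rewrite -(big_mkord xpredT (fun j => q`_j * z ^+ j)) (big_cat_nat (leq0n J) JN) /= [X in X - _]addrC addrK.
apply: le_trans (nc_sum _ _ _) _.
have zr01 : 0 <= nc z / rho < 1.
  by rewrite divr_ge0 ?nc_ge0 ?(ltW rho0) //= ltr_pdivrMr ?mul1r.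
apply: le_trans (ler_wpM2l Bd0 (geometric_tail zr01 JN)).
rewrite mulr_sumr; apply: ler_sum => j _; rewrite ncM ncX expr_div_n.
rewrite mulrA ler_pdivlMr ?exprn_gt0 //.
have -> : nc q`_j * nc z ^+ j * rho ^+ j = nc q`_j * rho ^+ j * nc z ^+ j by ring.
by rewrite ler_wpM2r ?exprn_ge0 ?nc_ge0.
Qed.

Lemma strictly_increasing_ge (n : nat -> nat) :
  (forall k l, (k < l)%N -> (n k < n l)%N) -> forall k, (k <= n k)%N.
Proof. by move=> n_incr; elim=> // k IH; apply: leq_ltn_trans IH (n_incr _ _ _). Qed.

End Final.

Theorem theorem16 (R : realType) (f : R[i]^o -> R[i]^o)
  (f_analytic : analytic_on_disk f) (f0 : f 0 = 1)
  (n : nat -> nat) (lambda : nat -> R) (p : nat -> {poly R[i]})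
  (n_gt0 : forall k : nat, (0 < n k)%N)
  (n_incr : forall k l : nat, (k < l)%N -> (n k < n l)%N)
  (lambda_bd : forall k : nat, 0 < lambda k < 2 * pi / (n k)%:R)
  (p_PD : forall k : nat, class_PD (n k) (lambda k) (p k))
  (p_inv0 : forall k : nat, (ninverse (n k) (p k)).[0] = 1)
  (p_cvg : forall K : set R[i]^o, compact K -> K `<=` @unit_disk R ->
     {uniform K, (fun (k : nat) (z : R[i]^o) =>
                    ((ninverse (n k) (p k)).[z] : R[i]^o)) @ \oo --> f}) :
  class_R1 f.
Proof.
split=> // z; rewrite /unit_disk /= normE -(rmorph1 (real_complex R)) ltcR => z1.
pose r := Normc.normc z; have r0 : 0 <= r by exact: nc_ge0.
have r1 : r < 1 by exact: z1.
pose rho := (1 + r) / 2.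
have rho01 : 0 < rho < 1 by rewrite /rho; apply/andP; split; lra.
have /andP[rho0 rho1] := rho01; have rrho : r < rho by rewrite /rho; lra.
pose q k : {poly R[i]} := ninverse (n k) (p k).
pose Ci : set R[i]^o := (fun t : R => (rho%:C%C * expi t : R[i]^o)) @` `[0, 2 * pi].
(* The circle of radius [rho] gives the tail bounds, the point [z] the value of the limit. *)
pose K : set R[i]^o := Ci `|` [set z].
have K_disk : K `<=` @unit_disk R.
  move=> w; rewrite /unit_disk /= normE -(rmorph1 (real_complex R)) ltcR.
  case=> [[t _ <-]|->] //; rewrite ncM nc_expi nc_real gtr0_norm ?mulr1 //.
have K_compact : compact K.
  by apply: compactU; [exact: compact_circle | exact: compact_set1].
have qf : forall e : R, 0 < e -> exists N, forall k, (N <= k)%N ->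
    forall w, K w -> Normc.normc (f w - (q k).[w]) <= e.
  exact: uniform_cvg_nc (p_cvg K K_compact K_disk).
have [N1 HN1] := qf 1 ltr01.
have [Cb Cb0 HCb] := poly_disk_bounded (q N1).
(* All later polynomials are within [2] of the one of index [N1] on the circle. *)
pose Bd := Cb + 2.
have qBd k j : (N1 <= k)%N -> Normc.normc (q k)`_j * rho ^+ j <= Bd.
  move=> Nk; apply: coef_bound (ltW rho0) _ => t t2.
  have Kw : K (rho%:C%C * expi t) by left; exists t; rewrite // in_itv.
  have := HN1 k Nk _ Kw; have := HN1 N1 (leqnn _) _ Kw.
  move: (rho%:C%C * expi t) Kw => w Kw.
  have w1 : Normc.normc w <= 1.
    have := K_disk w Kw; rewrite /unit_disk /= normE -(rmorph1 (real_complex R)) ltcR.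
    exact: ltW.
  have := HCb w w1; have := ncD (f w - (q N1).[w]) (- (f w - (q k).[w])).
  have := ncD (f w - (q N1).[w] - (f w - (q k).[w])) (q N1).[w].
  have -> : f w - (q N1).[w] - (f w - (q k).[w]) + (q N1).[w] = (q k).[w] by ring.
  rewrite ncN /Bd; lra.
have Kz : K z by right.
have b0 k : (q k)`_0 = 1 by rewrite -horner_coef0 p_inv0.
apply: (@Re_gt_half _ _ r); first by rewrite r0.
apply: (@le_of_eps _ _ _ (Bd / (1 - r / rho) + 3 + (1 - r)^-1)).
  have rr1 : r / rho < 1 by rewrite ltr_pdivrMr ?mul1r.
  have Bd0 : 0 <= Bd by rewrite /Bd addr_ge0.
  by rewrite !addr_ge0 ?divr_ge0 ?invr_ge0 ?subr_ge0 // ltW.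
move=> e /andP[e0 _].
have rr01 : 0 <= r / rho < 1.
  by rewrite divr_ge0 ?(ltW rho0) //= ltr_pdivrMr ?mul1r.
have [J HJ] := exists_expr_lt rr01 e0.
have rJ : r ^+ J <= e.
  apply: le_trans (ltW HJ); rewrite lerXn2r ?nnegrE //; first by case/andP: rr01.
  by rewrite ler_pdivlMr // ler_piMr // ltW.
have [N2 HN2] := qf e e0.
pose T : R := \sum_(j < J) j%:R ^+ 3 * (16 * J%:R).
have T0 : 0 <= T by apply: sumr_ge0 => j _; rewrite !mulr_ge0 ?exprn_ge0.
(* From this index on, [T / n k] is at most [e]. *)
pose N3 := (Num.truncn (T / e)).+1.
pose k := maxn (maxn N1 N2) (maxn N3 (2 * J)).
have nk := strictly_increasing_ge n_incr k.
have kN1 : (N1 <= k)%N by rewrite /k !leq_max leqnn.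
have kN2 : (N2 <= k)%N by rewrite /k !leq_max leqnn orbT.
have kN3 : (N3 <= k)%N by rewrite /k !leq_max leqnn !orbT.
have kJ : (2 * J <= n k)%N by apply: leq_trans nk; rewrite /k !leq_max leqnn !orbT.
have nk0 : 0 < (n k)%:R :> R by rewrite ltr0n.
have Tn : T / (n k)%:R <= e.
  rewrite ler_pdivrMr // mulrC -ler_pdivrMr //.
  apply: (@le_trans _ _ N3%:R); first by rewrite ltW // truncnS_gt.
  by rewrite ler_nat (leq_trans kN3).
have [c [c0 cc bc]] := class_PD_contractive (n_gt0 k) (lambda_bd k) (p_PD k) (b0 k) kJ.
(* The error at [z] is split into the distance of [f] to the [k]-th polynomial, its tail after [J] terms,
   the change of its first [J] coefficients, and the partial sum of the contractive sequence. *)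
have step1 := HN2 k kN2 z Kz.
have step2 := @horner_tail R (q k) z rho Bd J rho0 (fun j => qBd k j kN1) rrho.
have step4 := contractive_partial_sum J cc c0 z1.
pose S1 := \sum_(j < J) (q k)`_j * z ^+ j; pose S2 := \sum_(j < J) c j * z ^+ j.
have step3 : Normc.normc (S1 - S2) <= e.
  apply: le_trans Tn; rewrite /S1 /S2 -sumrB; apply: le_trans (nc_sum _ _ _) _.
  rewrite /T mulr_suml; apply: ler_sum => j _; rewrite -mulrBl ncM ncX.
  rewrite -mulrA; apply: le_trans (bc j (ltnW (ltn_ord j))).
  by rewrite ler_piMr ?nc_ge0 // exprn_ile1 // ltW.
have {}step2 : Normc.normc ((q k).[z] - S1) <= Bd / (1 - r / rho) * e.
  apply: le_trans step2 _; rewrite mulrCA mulrC ler_wpM2l ?(ltW HJ) //.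
  rewrite divr_ge0 ?subr_ge0 ?addr_ge0 // ltW //; by case/andP: rr01.
have {}step4 : Normc.normc (S2 - ((1 - r ^+ 2)^-1)%:C%C) <= r / (1 - r ^+ 2) + (1 - r)^-1 * e.
  apply: le_trans step4 _; rewrite lerD2l mulrC ler_wpM2l //.
  by rewrite invr_ge0 subr_ge0 ltW.
have -> : f z - ((1 - r ^+ 2)^-1)%:C%C = (f z - (q k).[z]) + ((q k).[z] - S1) +
   (S1 - S2) + (S2 - ((1 - r ^+ 2)^-1)%:C%C) by ring.
apply: le_trans (ncD _ _) _; apply: le_trans (lerD (ncD _ _) (lexx _)) _.
apply: le_trans (lerD (lerD (ncD _ _) (lexx _)) (lexx _)) _.
by move: (Bd / (1 - r / rho)) ((1 - r)^-1) step2 step4 => x y step2 step4; lra.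
Qed.
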